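(* Let $T$ be injective, bisectorial of angle $\omega\in(0,\frac{\pi}{2})$ and have a bounded $H^\infty$-functional calculus. Let $P_\pm=\mathds{1}_\pm(T)$ be its spectral projectors and $V_\pm:=\operatorname{ran}P_\pm$. Then $V_+$ and $V_-$ are closed, right linear subspaces of $V$, and the whole space admits the direct sum decomposition $$V=V_+\overset{\bullet}{+}V_-,$$ i.e. $V=V_++V_-$ and $V_+\cap V_-=\{0\}$.
   Context: **Clifford algebra and modules.** Let $n\in\mathbb{N}$ and let $\mathbb{R}_n$ be the real Clifford algebra generated by $e_1,\dots,e_n$ with $e_i^2=-1$, $e_ie_j=-e_je_i$ for $i\neq j$. $\overline{\,\cdot\,}$ is Clifford conjugation (the real-linear anti-automorphism with $\overline{e_i}=-e_i$), $\operatorname{Sc}$ is the scalar part, $|\cdot|$ is the Euclidean norm. Paravectors: $\mathbb{R}^{n+1}=\{x_0+x_1e_1+\dots+x_ne_n\mid x_i\in\mathbb{R}\}$, with $s_0=\operatorname{Sc}(s)$. $\mathbb{S}=\{x_1e_1+\dots+x_ne_n\mid x_1^2+\dots+x_n^2=1\}$; for $J\in\mathbb{S}$, $\mathbb{C}_J=\{x+Jy\mid x,y\in\mathbb{R}\}$. $V$ is a right Hilbert module: a real vector space which is a right $\mathbb{R}_n$-module (extending real scalar multiplication), with an $\mathbb{R}$-bilinear form $\langle\cdot,\cdot\rangle:V\times V\to\mathbb{R}_n$ satisfying $\langle vs,w\rangle=\overline{s}\langle v,w\rangle$, $\langle v,ws\rangle=\langle v,w\rangle s$, $\overline{\langle v,w\rangle}=\langle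 w,v\rangle$, and such that $(V,\operatorname{Sc}\langle\cdot,\cdot\rangle)$ is a real Hilbert space; $\|v\|^2=\operatorname{Sc}\langle v,v\rangle$. **Operators and $S$-spectrum.** $T:\operatorname{dom}T\to V$ is right linear if $\operatorname{dom}T$ is a right submodule, $T$ is additive and $T(vs)=(Tv)s$ for $s\in\mathbb{R}_n$. $\mathcal{K}(V)$ is the set of closed right linear operators, $\mathcal{B}(V)$ the set of everywhere defined bounded right linear operators. For $s\in\mathbb{R}^{n+1}$: $Q_s[T]=T^2-2s_0T+|s|^2$ with domain $\operatorname{dom}T^2$; $\rho_S(T)=\{s\in\mathbb{R}^{n+1}\mid Q_s[T]^{-1}\in\mathcal{B}(V)\}$, $\sigma_S(T)=\mathbb{R}^{n+1}\setminus\rho_S(T)$. $\mathcal{I}^Rs:V\to V$ is right multiplication $v\mapsto vs$. One has $s\in\rho_S(T)$ iff $\mathcal{I}^Rs-T$ is bijective from $\operatorname{dom}T$ onto $V$. **Bisectorial operators.** $S_\omega=\{s\in\mathbb{R}^{n+1}\setminus\{0\}\mid|\operatorname{Arg}(s)|<\omega\}$, where $\operatorname{Arg}(s)=\arccos(s_0/|s|)$; $D_\omega=S_\omega\cup(-S_\omega)$ for $\omega\in(0,\frac{\pi}{2})$. $T\in\mathcal{K}(V)$ is bisectorial of angle $\omega\in(0,\frac{\pi}{2})$ if $\sigma_S(T)\subseteq\overline{D_\omega}$ and for every $\varphi\in(\omega,\frac{\pi}{2})$ there is $C_\varphi\ge0$ with $\|(\mathcal{I}^Rs-T)^{-1}\|\le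 C_\varphi/|s|$ for all $s\in\mathbb{R}^{n+1}\setminus(D_\varphi\cup\{0\})$. **Functions.** For $U\subseteq\mathbb{R}^{n+1}$ open and axially symmetric ($x+Jy\in U$ implies $x+Iy\in U$ for all $I\in\mathbb{S}$), $f:U\to\mathbb{R}^{n+1}$ is intrinsic if $f(x+Jy)=\alpha(x,y)+J\beta(x,y)$ with real-valued $\alpha,\beta$ independent of $J$, satisfying the Cauchy–Riemann equations, $\alpha$ even and $\beta$ odd in $y$. $\mathcal{N}^0(U)$: intrinsic $f$ with $|f(s)|\le C|s|^\alpha/(1+|s|^{2\alpha})$ for some $\alpha>0$, $C\ge0$. $\mathcal{N}^\infty(U)$: bounded intrinsic $f$, with $\|f\|_\infty=\sup_U|f|$. **Functional calculus.** Let $T$ be injective and bisectorial of angle $\omega$. For $f\in\mathcal{N}^0(D_\theta)$, $\theta\in(\omega,\frac{\pi}{2})$, $$f(T)v=\frac{1}{2\pi}\int_{\partial D_\varphi\cap\mathbb{C}_J}(\mathcal{I}^Rs-T)^{-1}vf(s)\,ds_J,$$ with $\varphi\in(\omega,\theta)$ and $J\in\mathbb{S}$ arbitrary, $ds_J=ds/J$, and the boundary oriented so that the double sector lies to its left. For $f\in\mathcal{N}^\infty(D_\theta)$, $f(T)=e(T)^{-1}(ef)(T)$ (with natural domain), where $e\in\mathcal{N}^0(D_\theta)$ is any function with $ef\in\mathcal{N}^0(D_\theta)$ and $e(T)$ injective, e.g. $e(s)=\frac{s}{1+s^2}$; $f(T)$ is independent of the choice of $e$. An injective bisectorial operator $T$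 of angle $\omega$ has a bounded $H^\infty$-functional calculus if for every $\theta\in(\omega,\frac{\pi}{2})$ there is $C_\theta\ge0$ such that $f(T)\in\mathcal{B}(V)$ and $\|f(T)\|\le C_\theta\|f\|_\infty$ for all $f\in\mathcal{N}^\infty(D_\theta)$. **Spectral projectors.** $\mathds{1}_+(s)=1$ if $\operatorname{Sc}(s)>0$ and $0$ if $\operatorname{Sc}(s)<0$; $\mathds{1}_-(s)=0$ if $\operatorname{Sc}(s)>0$ and $1$ if $\operatorname{Sc}(s)<0$ (functions in $\mathcal{N}^\infty(D_\theta)$). For $T$ injective, bisectorial with bounded $H^\infty$-functional calculus, $P_+=\mathds{1}_+(T)$ and $P_-=\mathds{1}_-(T)$; these lie in $\mathcal{B}(V)$. *)

(* Defs.v *)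
From Stdlib Require Import Reals.
From HB Require Import structures.
From mathcomp Require Import all_boot all_algebra.
From mathcomp Require Import ring Rstruct.
From Coquelicot Require Import Coquelicot.

Set Implicit Arguments.
Unset Strict Implicit.
Unset Printing Implicit Defensive.

Import GRing.Theory.

(* The Clifford algebra with n generators, e_i ^ 2 = -1, over a commutative   *)
(* ring K.  The blade of A : {set 'I_n} is the product of the e_i, i in A, in *)
(* increasing order of the indices; an element is the family of its           *)
(* coordinates with respect to the blades.                                    *)

Section SymmetricDifference.
Variable T : finType.
Implicit Types A B C : {set T}.

Definition symdiff A B : {set T} := [set i | (i \in A) (+) (i \in B)].

Lemma symdiffE A B i : (i \in symdiff A B) = (i \in A) (+) (i \in B).
Proof. by rewrite inE. Qed.

Lemma symdiffA A B C : symdiff A (symdiff B C) = symdiff (symdiff A B) C.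
Proof. by apply/setP => i; rewrite !symdiffE addbA. Qed.

Lemma symdiffC A B : symdiff A B = symdiff B A.
Proof. by apply/setP => i; rewrite !symdiffE addbC. Qed.

Lemma symdiff0 A : symdiff A set0 = A.
Proof. by apply/setP => i; rewrite symdiffE inE addbF. Qed.

Lemma symdiffKl A B : symdiff A (symdiff A B) = B.
Proof. by apply/setP => i; rewrite !symdiffE addKb. Qed.

End SymmetricDifference.

Local Open Scope ring_scope.

Definition cliff (K : comNzRingType) (n : nat) : Type := {ffun {set 'I_n} -> K}.

HB.instance Definition _ (K : comNzRingType) (n : nat) :=
  GRing.Lmodule.copy (cliff K n) {ffun {set 'I_n} -> K^o}.

Section Clifford.
Variables (K : comNzRingType) (n : nat).
Implicit Types (A B C : {set 'I_n}) (a b c : cliff K n).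

(* blade A * blade B = blade_sign A B *: blade (symdiff A B): every pair      *)
(* i \in A, j \in B contributes a sign, by e_i e_j = - e_j e_i if j < i and   *)
(* by e_i ^ 2 = -1 if j = i.                                                  *)
Definition blade_sign A B : K :=
  \prod_(i in A) \prod_(j in B) (if (j <= i)%N then -1 else 1).

Definition blade A : cliff K n := [ffun B => (B == A)%:R].

Definition cliff_one : cliff K n := blade set0.

(* The pairs (A, B) with symdiff A B = C are the pairs (A, symdiff A C). *)
Definition cliff_mul a b : cliff K n :=
  [ffun C => \sum_A blade_sign A (symdiff A C) * (a A * b (symdiff A C))].

Lemma prod_sign_symdiff (F : 'I_n -> K) A B : (forall i, F i * F i = 1) ->
  \prod_(i in symdiff A B) F i = (\prod_(i in A) F i) * (\prod_(i in B) F i).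
Proof.
move=> FF; rewrite !(big_mkcond (fun i => i \in _)) /= -big_split /=.
apply: eq_bigr => i _; rewrite symdiffE.
by case: (i \in A); case: (i \in B); rewrite /= ?FF ?mul1r ?mulr1.
Qed.

Lemma sign_sq (p : bool) : (if p then -1 else 1) * (if p then -1 else 1) = 1 :> K.
Proof. by case: p; rewrite ?mulr1 // mulN1r opprK. Qed.

Lemma blade_sign_sq A B : blade_sign A B * blade_sign A B = 1.
Proof.
rewrite /blade_sign -big_split big1 //= => i _; rewrite -big_split big1 //= => j _.
exact: sign_sq.
Qed.

Lemma blade_signDr A B C :
  blade_sign A (symdiff B C) = blade_sign A B * blade_sign A C.
Proof.
rewrite /blade_sign -big_split; apply: eq_bigr => i _ /=.
by apply: prod_sign_symdiff => j; apply: sign_sq.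
Qed.

Lemma blade_signDl A B C :
  blade_sign (symdiff A B) C = blade_sign A C * blade_sign B C.
Proof.
apply: prod_sign_symdiff => i; rewrite -big_split big1 //= => j _.
exact: sign_sq.
Qed.

Lemma blade_sign0l A : blade_sign set0 A = 1.
Proof. by rewrite /blade_sign big1 // => i; rewrite inE. Qed.

Lemma blade_sign0r A : blade_sign A set0 = 1.
Proof. by rewrite /blade_sign big1 // => i _; rewrite big1 // => j; rewrite inE. Qed.

Fact cliff_mulA : associative cliff_mul.
Proof.
move=> a b c; apply/ffunP => D; rewrite !ffunE.
under eq_bigr => A _.
  rewrite ffunE (reindex_inj (can_inj (symdiffKl A))) /= !mulr_sumr; over.
under [RHS]eq_bigr => C _ do rewrite ffunE mulr_suml mulr_sumr.
rewrite exchange_big /=; apply: eq_bigr => C _; apply: eq_bigr => A _.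
have -> : symdiff (symdiff A C) (symdiff A D) = symdiff C D.
  by rewrite (symdiffC A C) -symdiffA symdiffKl.
have -> : blade_sign A (symdiff A D) =
          blade_sign A (symdiff A C) * blade_sign A (symdiff C D).
  by rewrite -blade_signDr -symdiffA symdiffKl.
have -> : blade_sign C (symdiff C D) =
          blade_sign A (symdiff C D) * blade_sign (symdiff A C) (symdiff C D).
  by rewrite -blade_signDl symdiffKl.
by ring.
Qed.

Fact cliff_mul1l : left_id cliff_one cliff_mul.
Proof.
move=> a; apply/ffunP => D; rewrite ffunE (bigD1 set0) //= big1.
  by rewrite addr0 blade_sign0l symdiffC symdiff0 ffunE eqxx !mul1r.
by move=> A /negPf A0; rewrite ffunE A0 mul0r mulr0.
Qed.

Fact cliff_mul1r : right_id cliff_one cliff_mul.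
Proof.
move=> a; apply/ffunP => D; rewrite ffunE (bigD1 D) //= big1.
  have -> : symdiff D D = set0 by rewrite -[X in symdiff _ X]symdiff0 symdiffKl.
  by rewrite addr0 blade_sign0r ffunE eqxx mul1r mulr1.
move=> A AD; rewrite [cliff_one _]ffunE; case: eqP => [AD0|_]; last by rewrite !mulr0.
by move: AD; rewrite -(symdiffKl A D) AD0 symdiff0 eqxx.
Qed.

Fact cliff_mulDl : left_distributive cliff_mul +%R.
Proof.
move=> a b c; apply/ffunP => D; rewrite !ffunE -big_split /=.
by apply: eq_bigr => A _; rewrite ffunE mulrDl mulrDr.
Qed.

Fact cliff_mulDr : right_distributive cliff_mul +%R.
Proof.
move=> a b c; apply/ffunP => D; rewrite !ffunE -big_split /=.
by apply: eq_bigr => A _; rewrite ffunE !mulrDr.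
Qed.

Fact cliff_one_neq0 : cliff_one != 0.
Proof.
by apply/eqP => /ffunP /(_ set0) /eqP; rewrite !ffunE eqxx oner_eq0.
Qed.

HB.instance Definition _ := GRing.Zmodule_isNzRing.Build (cliff K n)
  cliff_mulA cliff_mul1l cliff_mul1r cliff_mulDl cliff_mulDr cliff_one_neq0.

Fact cliff_scaleAl (k : K) a b : k *: (a * b) = (k *: a) * b.
Proof.
apply/ffunP => D; rewrite !ffunE scaler_sumr; apply: eq_bigr => A _.
by rewrite !ffunE /GRing.scale /= -!mulrA mulrCA.
Qed.

HB.instance Definition _ :=
  GRing.Lmodule_isLalgebra.Build K (cliff K n) cliff_scaleAl.

Fact cliff_scaleAr (k : K) a b : k *: (a * b) = a * (k *: b).
Proof.
apply/ffunP => D; rewrite !ffunE scaler_sumr; apply: eq_bigr => A _.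
by rewrite !ffunE /GRing.scale /= mulrCA; congr (_ * _); rewrite mulrCA.
Qed.

HB.instance Definition _ :=
  GRing.Lalgebra_isAlgebra.Build K (cliff K n) cliff_scaleAr.

Definition gen (i : 'I_n) : cliff K n := blade [set i].

Lemma blade_mul A B : blade A * blade B = blade_sign A B *: blade (symdiff A B).
Proof.
apply/ffunP => C; rewrite !ffunE (bigD1 A) //= big1 ?addr0.
  rewrite !ffunE eqxx mul1r.
  have [<-|ne] := eqVneq (symdiff A C) B; first by rewrite symdiffKl eqxx.
  rewrite mulr0; have [CE|_] := eqVneq C; last by rewrite scaler0.
  by move: ne; rewrite CE symdiffKl eqxx.
by move=> D /negPf DA; rewrite [blade A D]ffunE DA mul0r mulr0.
Qed.

Lemma blade_sign_gen i j :
  blade_sign [set i] [set j] = if (j <= i)%N then -1 else 1.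
Proof. by rewrite /blade_sign !big_set1. Qed.

Lemma gen_sqr i : gen i * gen i = -1.
Proof.
rewrite blade_mul blade_sign_gen leqnn scaleN1r; congr (- blade _).
by rewrite -[X in symdiff _ X]symdiff0 symdiffKl.
Qed.

Lemma gen_anticomm i j : i != j -> gen i * gen j = - (gen j * gen i).
Proof.
move=> ij; rewrite !blade_mul !blade_sign_gen symdiffC -scaleNr.
have := ij; rewrite -val_eqE neq_ltn => /orP[lt|lt].
  by rewrite (ltnW lt) leqNgt lt /= opprK.
by rewrite (ltnW lt) leqNgt lt.
Qed.

Lemma blade_genr A (j : 'I_n) : (forall i, i \in A -> (i < j)%N) ->
  blade A * gen j = blade (j |: A).
Proof.
move=> Aj; rewrite blade_mul /blade_sign big1 ?scale1r.
  congr blade; apply/setP => i; rewrite symdiffE !inE.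
  by case: eqVneq => [->|_]; [case: (boolP (j \in A)) => // /Aj; rewrite ltnn | rewrite addbF].
by move=> i /Aj ij; rewrite big_set1 leqNgt ij.
Qed.

(* The sign is that of blade A ^ 2: conjugation maps blade A to its inverse. *)
Definition conjug a : cliff K n := [ffun A => blade_sign A A * a A].

Lemma conjug_gen i : conjug (gen i) = - gen i.
Proof.
apply/ffunP => A; rewrite !ffunE; have [->|_] := eqVneq A; last by rewrite mulr0 oppr0.
by rewrite blade_sign_gen leqnn mulr1.
Qed.

Lemma conjugZ (k : K) a : conjug (k *: a) = k *: conjug a.
Proof. by apply/ffunP => A; rewrite !ffunE /GRing.scale /= mulrCA. Qed.

Lemma conjugD a b : conjug (a + b) = conjug a + conjug b.
Proof. by apply/ffunP => A; rewrite !ffunE mulrDr. Qed.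

Lemma conjugM a b : conjug (a * b) = conjug b * conjug a.
Proof.
apply/ffunP => C; rewrite !ffunE mulr_sumr.
have symdiffCK (D E : {set 'I_n}) : symdiff (symdiff D E) E = D.
  by rewrite symdiffC (symdiffC D) symdiffKl.
rewrite [RHS](reindex_inj (h := fun A => symdiff A C)) /=; last first.
  exact: (can_inj (g := fun A => symdiff A C)) (fun A => symdiffCK A C).
apply: eq_bigr => A _; rewrite !ffunE symdiffCK.
have : symdiff A (symdiff A C) = C by rewrite symdiffKl.
move: (symdiff A C) => B <-; rewrite blade_signDl !blade_signDr.
transitivity (blade_sign A B * blade_sign A B * blade_sign B A *
  (blade_sign B B * b B * (blade_sign A A * a A))); first by ring.
by rewrite blade_sign_sq mul1r.
Qed.

End Clifford.

Section Paravectors.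
Variable n : nat.
Implicit Types (s t J : cliff R n) (U : cliff R n -> Prop)
  (f : cliff R n -> cliff R n).

Definition Sc s : R := s set0.

Definition cnorm s : R := sqrt (\sum_A s A ^+ 2).

Definition paravector s : Prop :=
  exists (x0 : R) (x : 'I_n -> R), s = x0%:A + \sum_i x i *: gen R i.

Definition imag_sphere J : Prop :=
  exists x : 'I_n -> R, \sum_i x i ^+ 2 = 1 /\ J = \sum_i x i *: gen R i.

Definition cplane J (x y : R) : cliff R n := x%:A + y *: J.

Definition cexp J (phi : R) : cliff R n := cplane J (cos phi) (sin phi).

Local Open Scope R_scope.

Definition Arg s : R := acos (Sc s / cnorm s).

Definition sector (omega : R) s : Prop :=
  [/\ paravector s, s <> GRing.zero & Rabs (Arg s) < omega].

Definition double_sector (omega : R) s : Prop :=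
  sector omega s \/ sector omega (GRing.opp s).

(* The closure in the space of paravectors, for U a set of paravectors. *)
Definition para_closure U s : Prop :=
  paravector s /\
  forall eps, 0 < eps -> exists2 t, U t & cnorm (GRing.add s (GRing.opp t)) < eps.

(* gx and gy are the partial derivatives of g. *)
Definition C1_at (g gx gy : R -> R -> R) (x y : R) : Prop :=
  [/\ is_derive (fun h => g h y) x (gx x y), is_derive (fun h => g x h) y (gy x y),
      continuity_2d_pt gx x y & continuity_2d_pt gy x y].

(* U is meant to be open and axially symmetric. *)
Definition intrinsic U f : Prop :=
  exists alpha beta alpha_x alpha_y beta_x beta_y : R -> R -> R,
  forall (x y : R) J, imag_sphere J -> U (cplane J x y) ->
  [/\ f (cplane J x y) = cplane J (alpha x y) (beta x y),
      C1_at alpha alpha_x alpha_y x y /\ C1_at beta beta_x beta_y x y,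
      alpha_x x y = beta_y x y /\ alpha_y x y = - beta_x x y &
      alpha x (- y) = alpha x y /\ beta x (- y) = - beta x y].

(* Rpower r a is r ^ a for 0 < r only, so U should not contain 0. *)
Definition N0 U f : Prop :=
  intrinsic U f /\
  exists a C : R, [/\ 0 < a, 0 <= C & forall s, U s ->
    cnorm (f s) <= C * Rpower (cnorm s) a / (1 + Rpower (cnorm s) (2 * a))].

Definition Ninfty U f : Prop :=
  intrinsic U f /\ exists C : R, forall s, U s -> cnorm (f s) <= C.

Definition sup_norm U f : R :=
  real (Lub_Rbar (fun r => exists2 s, U s & r = cnorm (f s))).

Definition ind_pos s : cliff R n :=
  if Rlt_dec 0 (Sc s) then GRing.one _ else GRing.zero.

Definition ind_neg s : cliff R n :=
  if Rlt_dec (Sc s) 0 then GRing.one _ else GRing.zero.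

End Paravectors.

(* The carrier is a real Banach space whose norm is the one given by the real *)
(* inner product Sc (form v w), by norm_form.                                 *)

Record rightHilbertModule (n : nat) := RightHilbertModule {
  carrier :> CompleteNormedModule R_AbsRing;
  act : carrier -> cliff R n -> carrier;
  form : carrier -> carrier -> cliff R n;
  actDl : forall v w s, act (plus v w) s = plus (act v s) (act w s);
  actDr : forall v (s t : cliff R n), act v (s + t) = plus (act v s) (act v t);
  actM : forall v (s t : cliff R n), act v (s * t) = act (act v s) t;
  act_scal : forall v (x : R), act v x%:A = scal x v;
  formDl : forall u v w, form (plus u v) w = form u w + form v w;
  formDr : forall u v w, form u (plus v w) = form u v + form u w;
  formZl : forall (x : R) v w, form (scal x v) w = x *: form v w;
  formZr : forall (x : R) v w, form v (scal x w) = x *: form v w;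
  form_actl : forall v w s, form (act v s) w = conjug s * form v w;
  form_actr : forall v w s, form v (act w s) = form v w * s;
  form_conj : forall v w, conjug (form v w) = form w v;
  norm_form : forall v, norm v ^+ 2 = Sc (form v v)
}.

Section Operators.
Variables (n : nat) (V : rightHilbertModule n).
Implicit Types (v w : V) (s J : cliff R n) (f : cliff R n -> cliff R n)
  (W : V -> Prop).

(* Operators are given by their graphs: A v w means that v is in the domain   *)
(* of A and A v = w.                                                          *)
Definition operator : Type := V -> V -> Prop.

Implicit Types (A B T : operator).

Definition right_submodule W : Prop :=
  [/\ W zero, forall v w, W v -> W w -> W (plus v w)
    & forall v s, W v -> W (act v s)].

Definition right_linear A : Prop :=
  [/\ forall v w w', A v w -> A v w' -> w = w',
      A zero zero,
      forall v v' w w', A v w -> A v' w' -> A (plus v v') (plus w w')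
    & forall v w s, A v w -> A (act v s) (act w s)].

Definition closed_op A : Prop := closed (fun p : V * V => A p.1 p.2).

Definition op_inv A : operator := fun w v => A v w.

(* First A, then B. *)
Definition op_comp B A : operator := fun v w => exists2 u, A v u & B u w.

Definition op_injective A : Prop := forall v v' w, A v w -> A v' w -> v = v'.

Definition ran A : V -> Prop := fun w => exists v, A v w.

Definition op_norm_le A (C : R) : Prop :=
  forall v w, A v w -> Rle (norm w) (Rmult C (norm v)).

Definition bounded_op A : Prop :=
  [/\ right_linear A, forall v, exists w, A v w & exists C, op_norm_le A C].

Definition Q s T : operator := fun v w =>
  exists u u' : V, [/\ T v u, T u u' &
    w = plus (minus u' (scal (Rmult 2 (Sc s)) u)) (scal (cnorm s ^+ 2) v)].

Definition rho_S T s : Prop := paravector s /\ bounded_op (op_inv (Q s T)).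

Definition sigma_S T s : Prop := paravector s /\ ~ rho_S T s.

(* v |-> v s - T v *)
Definition right_shift s T : operator :=
  fun v w => exists2 u, T v u & w = minus (act v s) u.

Definition resolvent s T : operator := op_inv (right_shift s T).

Local Open Scope R_scope.

Definition bisectorial (omega : R) T : Prop :=
  [/\ 0 < omega < PI / 2, right_linear T /\ closed_op T,
      forall s, sigma_S T s -> para_closure (double_sector omega) s
    & forall phi, omega < phi < PI / 2 -> exists2 C, 0 <= C &
        forall s, paravector s -> s <> GRing.zero -> ~ double_sector phi s ->
        op_norm_le (resolvent s T) (C / cnorm s)].

(* l is the integral of (s - T)^-1 v f(s) ds_J along s = r d, 0 < r < +oo;    *)
(* there ds_J = ds / J = d (- J) dr since J ^ 2 = - 1.                        *)
Definition ray_integral T f J (d : cliff R n) v (l : V) : Prop :=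
  is_RInt_gen
    (fun r : R =>
       let s := GRing.scale r d in
       act (act (iota (resolvent s T v)) (f s)) (GRing.mul d (GRing.opp J)))
    (at_right 0) (Rbar_locally p_infty) l.

(* The boundary of the double sector with angle phi in the plane C_J consists *)
(* of the rays in the directions +- exp(J phi), run through from infinity to  *)
(* 0, and +- exp(- J phi), run through from 0 to infinity.                    *)
Definition calc_N0_at T f J (phi : R) : operator := fun v w =>
  exists l1 l2 l3 l4 : V,
  [/\ ray_integral T f J (cexp J phi) v l1 /\
      ray_integral T f J (cexp J (- phi)) v l2,
      ray_integral T f J (GRing.opp (cexp J phi)) v l3 /\
      ray_integral T f J (GRing.opp (cexp J (- phi))) v l4
    & w = scal (/ (2 * PI)) (plus (minus l2 l1) (minus l4 l3))].

(* f(T) for f in N0 (double_sector theta); the choice of phi and J is         *)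
(* immaterial.                                                                *)
Definition calc_N0 (omega theta : R) T f : operator := fun v w =>
  exists phi J, [/\ omega < phi < theta, imag_sphere J & calc_N0_at T f J phi v w].

Definition regularizer (omega theta : R) T f (e : cliff R n -> cliff R n) : Prop :=
  [/\ N0 (double_sector theta) e,
      N0 (double_sector theta) (fun s => GRing.mul (e s) (f s))
    & op_injective (calc_N0 omega theta T e)].

(* f(T) = e(T)^-1 (e f)(T) for f in Ninfty (double_sector theta); the choice  *)
(* of e is immaterial.                                                        *)
Definition calc_Ninfty (omega theta : R) T f : operator := fun v w =>
  exists2 e, regularizer omega theta T f e &
    op_comp (op_inv (calc_N0 omega theta T e))
            (calc_N0 omega theta T (fun s => GRing.mul (e s) (f s))) v w.

Definition bounded_Hinfty_calculus (omega : R) T : Prop :=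
  forall theta, omega < theta < PI / 2 -> exists2 C, 0 <= C &
    forall f, Ninfty (double_sector theta) f ->
      bounded_op (calc_Ninfty omega theta T f) /\
      op_norm_le (calc_Ninfty omega theta T f)
                 (C * sup_norm (double_sector theta) f).

Definition P_pos (omega theta : R) T : operator :=
  calc_Ninfty omega theta T (@ind_pos n).

Definition P_neg (omega theta : R) T : operator :=
  calc_Ninfty omega theta T (@ind_neg n).

End Operators.

(* Main.v *)
Require Import Defs.
From Stdlib Require Import Reals Lra Classical FunctionalExtensionality.
From mathcomp Require Import all_boot all_algebra.
From mathcomp Require Import Rstruct.
From Coquelicot Require Import Coquelicot.

(* Neither Cauchy's theorem nor the product rule of the functional calculus is
   needed: they are replaced by the single-valuedness that is part of the
   boundedness of the H^oo-calculus.  For f in N0 the operators f(T), computed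
   with any angle and any imaginary unit, are bounded and commute: joining the
   integrands at conjugate points s, conj s gives real combinations of Q_s^-1 v
   and T Q_s^-1 v, which commute with every bounded operator commuting with T.
   Let e be a regularizer of 1_+, and put e_+ = e 1_+, e_- = e 1_-.  As
   e(T) e_+(T) x = e_+(T) e(T) x, the vector e_+(T) x is a value, hence the
   value, of 1_+(T) at e(T) x; thus P_+ e(T) = e_+(T), P_- e(T) = e_-(T), and
   both projectors commute with e(T).  Adding up, e(T) (P_+ + P_-) = e(T), so
   P_+ + P_- = 1 since e(T) is injective.  For k < 1 close to 1, the function
   e_k = e_+ + k e_- is a regularizer of 1_+ as well, because
   e_k(T) = (1 - (1 - k) P_-) e(T) is injective.  Hence
   P_+ e_k(T) = e_+(T) = P_+ e(T), which says (1 - k) P_+ P_- e(T) = 0, and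
   P_+ P_- = 0 follows by injectivity of e(T).  So ran P_+ = ker P_- and
   ran P_- = ker P_+. *)

Set Implicit Arguments.
Unset Strict Implicit.
Unset Printing Implicit Defensive.

Local Open Scope R_scope.

(** * Bounded linear maps and integrals of vector-valued functions *)

Section ImproperIntegrals.
Context {U V : CompleteNormedModule R_AbsRing}.
Implicit Types (h : R -> U) (L : U -> V).

(** A bounded linear map commutes with Riemann sums and, being continuous, with their limit. *)
Lemma is_RInt_linear L h a b l : is_linear L ->
  is_RInt h a b l -> is_RInt (fun r => L (h r)) a b (L l).
Proof.
move=> linL hl.
have sumL ptd : L (Riemann_sum h ptd) = Riemann_sum (fun r => L (h r)) ptd.
  elim/(@SF_cons_ind R): ptd => [x0|x0 s IH].
    by rewrite /Riemann_sum /=; exact: (linear_zero _ linL).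
  rewrite !Riemann_sum_cons (linear_plus _ linL) (linear_scal _ linL) -IH.
  by [].
apply: (filterlim_ext (fun ptd => L (scal (sign (b - a)) (Riemann_sum h ptd)))).
  by move=> ptd; rewrite (linear_scal _ linL) sumL.
exact: (filterlim_comp _ _ _ _ _ _ _ _ hl (linear_cont L l linL)).
Qed.

Lemma is_RInt_gen_linear Fa Fb {FFa : Filter Fa} {FFb : Filter Fb} L h l :
  is_linear L ->
  is_RInt_gen h Fa Fb l -> is_RInt_gen (fun r => L (h r)) Fa Fb (L l).
Proof.
move=> linL hl P PL; have [S1 S2 FS1 FS2 hS] := hl _ (linear_cont L l linL P PL).
apply: (Filter_prod _ _ _ S1 S2 FS1 FS2) => a b Sa Sb.
have [y [hy Py]] := hS a b Sa Sb.
by exists (L y); split => //; apply: is_RInt_linear.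
Qed.

End ImproperIntegrals.

(** * Convergence of improper integrals dominated by a derivative *)

Section DominatedIntegrals.
Context {V : CompleteNormedModule R_AbsRing}.
Variables (h : R -> V) (g G : R -> R) (l0 l1 : R).
Hypothesis h_cont : forall r, 0 < r -> continuous h r.
Hypothesis g_cont : forall r, 0 < r -> continuous g r.
Hypothesis G_der : forall r, 0 < r -> is_derive G r (g r).
Hypothesis le_hg : forall r, 0 < r -> norm (h r) <= g r.
Hypothesis G_0 : filterlim G (at_right 0) (locally l0).
Hypothesis G_oo : filterlim G (Rbar_locally p_infty) (locally l1).

Lemma ex_RInt_pos a b : 0 < a -> 0 < b -> ex_RInt h a b.
Proof.
move=> a0 b0; apply: ex_RInt_continuous => r [ar _]; apply: h_cont.
by apply: Rlt_le_trans ar; apply: Rmin_pos.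
Qed.

Lemma is_RInt_majorant a b : 0 < a -> 0 < b -> is_RInt g a b (G b - G a).
Proof.
move=> a0 b0; have pos r : Rmin a b <= r -> 0 < r.
  by apply: Rlt_le_trans; apply: Rmin_pos.
by apply: is_RInt_derive => r [/pos r0 _]; [apply: G_der|apply: g_cont].
Qed.

(** The absolute value covers [b < a]: the end pieces met in the Cauchy criterion come in either
    orientation. *)
Lemma norm_RInt_dominated a b : 0 < a -> 0 < b ->
  norm (RInt h a b) <= Rabs (G b - G a).
Proof.
have le_ab x y : 0 < x -> 0 < y -> x <= y ->
    norm (RInt h x y) <= Rabs (G y - G x).
  move=> x0 y0 xy; apply: Rle_trans (Rle_abs _).
  apply: (norm_RInt_le _ _ _ _ _ _ xy _ (RInt_correct _ _ _ (ex_RInt_pos x0 y0))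
           (is_RInt_majorant x0 y0)) => r [xr _].
  by apply: le_hg; apply: Rlt_le_trans xr.
move=> a0 b0; have [ab|ba] := Rle_or_lt a b; first exact: le_ab.
rewrite -opp_RInt_swap; last exact: ex_RInt_pos.
by rewrite norm_opp Rabs_minus_sym; apply: le_ab => //; apply: Rlt_le.
Qed.

Lemma at_right0_pos : at_right 0 (fun r => 0 < r).
Proof. by exists (mkposreal 1 Rlt_0_1) => r _. Qed.

Lemma pinfty_pos : Rbar_locally p_infty (fun r => 0 < r).
Proof. by exists 0. Qed.

(** Integrals of [h] are bounded by increments of [G], and [G] has limits at both ends, so the
    truncated integrals satisfy the Cauchy criterion. *)
Lemma is_RInt_gen_dominated :
  exists2 l, is_RInt_gen h (at_right 0) (Rbar_locally p_infty) l
    & norm l <= l1 - l0.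
Proof.
pose F := filter_prod (at_right 0) (Rbar_locally p_infty).
have F_pos : F (fun ab => 0 < ab.1 /\ 0 < ab.2).
  by apply: (Filter_prod _ _ _ _ _ at_right0_pos pinfty_pos).
have [l hl] : exists l, filterlim (fun ab => RInt h ab.1 ab.2) F (locally l).
  apply/filterlim_locally_cauchy => eps.
  have e4 : 0 < eps / 4 by have := cond_pos eps; lra.
  exists (fun ab => [/\ 0 < ab.1, 0 < ab.2, Rabs (G ab.1 - l0) < eps / 4 &
                        Rabs (G ab.2 - l1) < eps / 4]); split.
    have B0 := G_0 (locally_ball l0 (mkposreal _ e4)).
    have B1 := G_oo (locally_ball l1 (mkposreal _ e4)).
    apply: (Filter_prod _ _ _ _ _ (filter_and _ _ at_right0_pos B0)
             (filter_and _ _ pinfty_pos B1)) => a b [a0 Ga] [b0 Gb]; split => //.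
  case=> [a b] [a' b'] /= [a0 b0 Ga Gb] [a0' b0' Ga' Gb'].
  apply: norm_compat1.
  (* Two truncated integrals differ by integrals over the two end pieces. *)
  have -> : minus (RInt h a' b') (RInt h a b) =
            plus (RInt h a' a) (RInt h b b').
    rewrite -(RInt_Chasles h a' a b'); [|exact: ex_RInt_pos..].
    rewrite -(RInt_Chasles h a b b'); [|exact: ex_RInt_pos..].
    rewrite /minus -plus_assoc; congr plus.
    by rewrite plus_comm plus_assoc plus_opp_l plus_zero_l.
  apply: Rle_lt_trans (norm_triangle _ _) _.
  have Na := norm_RInt_dominated a0' a0; have Nb := norm_RInt_dominated b0 b0'.
  by split_Rabs; lra.
have hgen : is_RInt_gen h (at_right 0) (Rbar_locally p_infty) l.
  apply: (filterlimi_lim_ext_loc (fun ab => RInt h ab.1 ab.2)) => //.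
  apply: filter_imp F_pos => -[a b] /= [a0 b0].
  by apply: RInt_correct; apply: ex_RInt_pos.
have ggen : is_RInt_gen g (at_right 0) (Rbar_locally p_infty) (l1 - l0).
  apply: (filterlimi_lim_ext_loc (fun ab => G ab.2 - G ab.1)).
    by apply: filter_imp F_pos => -[a b] /= [a0 b0]; apply: is_RInt_majorant.
  apply: (filterlim_comp_2 (fun ab => G ab.2) (fun ab => - G ab.1) Rplus
             (G := locally l1) (H := locally (- l0))).
    - exact: (filterlim_comp _ _ _ _ _ _ _ _ filterlim_snd G_oo).
    - exact: (filterlim_comp _ _ _ _ _ _ _ _ filterlim_fst
                (filterlim_comp _ _ _ _ _ _ _ _ G_0 (filterlim_opp l0))).
    - exact: (filterlim_plus l1 (- l0)).
exists l => //; apply: (RInt_gen_norm h g _ _ _ _ hgen ggen).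
  (* Eventually [a < 1 < b], so the bounds are ordered as the norm comparison requires. *)
  have a1 : at_right 0 (fun r => r < 1).
    exists (mkposreal 1 Rlt_0_1) => r.
    rewrite /ball /= /AbsRing_ball /= /abs /minus /plus /opp /=.
    by move=> H _; split_Rabs; lra.
  apply: (Filter_prod _ _ _ _ _ a1 (ex_intro _ 1 (fun _ => id))) => a b /=; lra.
apply: filter_imp F_pos => -[a b] /= [a0 b0] r [ar _].
by apply: le_hg; apply: Rlt_le_trans ar.
Qed.

End DominatedIntegrals.

(** * Scalar part, conjugation and the complex planes of the Clifford algebra *)

Section Clifford.
Import GRing.Theory.
Local Open Scope ring_scope.
Variable n : nat.
Implicit Types (a b s t J : cliff R n) (x y : R).

(** Doubling [J * J] symmetrises the double sum into anticommutators of generators, which vanish off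
    the diagonal and equal -2 on it. *)
Lemma imag_sphere_sqr J : imag_sphere J -> J * J = -1.
Proof.
case=> x [x1 ->]; apply: (@scalerI _ _ 2%:R); first by rewrite Num.Theory.pnatr_eq0.
rewrite scalerN scaler_nat mulr2n.
transitivity (\sum_i \sum_j (x i * x j) *: (gen R i * gen R j + gen R j * gen R i)).
  rewrite mulr_suml [in RHS](eq_bigr (fun i =>
    \sum_j (x i * x j) *: (gen R i * gen R j) +
    \sum_j (x i * x j) *: (gen R j * gen R i))); last first.
    by move=> i _; rewrite -big_split; apply: eq_bigr => j _; rewrite scalerDr.
  rewrite big_split /= [X in _ = _ + X]exchange_big /=.
  have E : \sum_i (x i *: gen R i * \sum_j x j *: gen R j) =
           \sum_i \sum_j (x i * x j) *: (gen R i * gen R j).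
    apply: eq_bigr => i _; rewrite mulr_sumr; apply: eq_bigr => j _.
    by rewrite -scalerAl -scalerAr scalerA.
  rewrite E; congr (_ + _).
  by apply: eq_bigr => i _; apply: eq_bigr => j _; rewrite mulrC.
transitivity (\sum_i (x i ^+ 2) *: (- 2%:R : cliff R n)).
  apply: eq_bigr => i _; rewrite (bigD1 i) //= big1 ?addr0; last first.
    by move=> j ji; rewrite (gen_anticomm _ ji) subrr scaler0.
  by rewrite gen_sqr expr2; congr (_ *: _); rewrite -opprD.
by rewrite -scaler_suml x1 scale1r scaler_nat.
Qed.

Lemma Sc_mul a b : Sc (a * b) = \sum_A blade_sign R A A * (a A * b A).
Proof. by rewrite /Sc ffunE; apply: eq_bigr => A _; rewrite symdiff0. Qed.

(** The scalar part is a trace: only products of equal blades contribute to it. *)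
Lemma Sc_mulC a b : Sc (a * b) = Sc (b * a).
Proof. by rewrite !Sc_mul; apply: eq_bigr => A _; rewrite (mulrC (a A)). Qed.

Lemma ScZ x a : Sc (x *: a) = x * Sc a.
Proof. by rewrite /Sc ffunE. Qed.

Lemma ScD a b : Sc (a + b) = Sc a + Sc b.
Proof. by rewrite /Sc ffunE. Qed.

Lemma Sc1 : Sc (1 : cliff R n) = 1.
Proof. by rewrite /Sc ffunE eqxx. Qed.

Lemma Sc_imag J : imag_sphere J -> Sc J = 0.
Proof.
case=> x [_ ->]; rewrite /Sc sum_ffunE big1 // => i _; rewrite !ffunE.
rewrite [_ == _](_ : _ = false) ?scaler0 //; apply/eqP => /setP/(_ i).
by rewrite !inE eqxx.
Qed.

(** The two signs [blade_sign A A], one from [conjug] and one from the scalar part of the product,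
    cancel. *)
Lemma cnormE s : cnorm s = sqrt (Sc (conjug s * s)).
Proof.
rewrite /cnorm Sc_mul; congr sqrt; apply: eq_bigr => A _.
by rewrite ffunE mulrA mulrA blade_sign_sq mul1r expr2.
Qed.

Lemma conjug_imag J : imag_sphere J -> conjug J = - J.
Proof.
case=> x [_ ->]; apply/ffunP => A; rewrite !ffunE !sum_ffunE mulr_sumr -sumrN.
apply: eq_bigr => i _; have /ffunP/(_ A) := conjug_gen R i.
by rewrite !ffunE /GRing.scale /= mulrCA => ->; rewrite mulrN.
Qed.

Lemma conjug1 : conjug (1 : cliff R n) = 1.
Proof.
apply/ffunP => A; rewrite !ffunE; case: eqVneq => [->|_]; last exact: mulr0.
by rewrite blade_sign0l mul1r.
Qed.

Section ComplexPlane.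
Variable J : cliff R n.
Hypothesis J_imag : imag_sphere J.

Lemma cplaneD x y x' y' :
  cplane J x y + cplane J x' y' = cplane J (x + x') (y + y').
Proof. by rewrite /cplane !RplusE !scalerDl addrACA. Qed.

Lemma cplaneN x y : - cplane J x y = cplane J (- x) (- y).
Proof. by rewrite /cplane !RoppE !scaleNr opprD. Qed.

Lemma cplaneZ k x y : k *: cplane J x y = cplane J (k * x) (k * y).
Proof. by rewrite /cplane !RmultE scalerDr !scalerA. Qed.

Lemma cplaneM x y x' y' : cplane J x y * cplane J x' y' =
  cplane J (x * x' - y * y') (x * y' + y * x').
Proof.
rewrite /cplane ?RminusE ?RplusE ?RoppE ?RmultE mulrDl !mulrDr.
rewrite -!scalerAl -!scalerAr !mul1r !mulr1.
rewrite (imag_sphere_sqr J_imag) !scalerA scalerBl scalerDl [X in _ + (_ + X)]scalerN.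
by rewrite [LHS](AC (2*2) ((1*4)*(2*3))).
Qed.

Lemma cplane_real x : x%:A = cplane J x 0.
Proof. by rewrite /cplane scale0r addr0. Qed.

Lemma cplane_imag : J = cplane J 0 1.
Proof. by rewrite /cplane scale0r add0r scale1r. Qed.

Lemma Sc_cplane x y : Sc (cplane J x y) = x.
Proof. by rewrite ScD !ScZ Sc1 (Sc_imag J_imag) mulr0 mulr1 addr0. Qed.

Lemma conjug_cplane x y : conjug (cplane J x y) = cplane J x (- y).
Proof.
by rewrite /cplane conjugD !conjugZ conjug1 (conjug_imag J_imag) scalerN RoppE scaleNr.
Qed.

Lemma cnorm_cplane x y : cnorm (cplane J x y) = sqrt (x * x + y * y).
Proof.
rewrite cnormE conjug_cplane cplaneM Sc_cplane; congr sqrt.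
rewrite !RmultE !RplusE ?RminusE ?RoppE; by rewrite mulNr opprK.
Qed.

Lemma paravector_cplane x y : paravector (cplane J x y).
Proof.
case: J_imag => z [_ JE]; exists x, (fun i => y * z i).
rewrite /cplane JE scaler_sumr; congr (_ + _); apply: eq_bigr => i _.
by rewrite scalerA.
Qed.

End ComplexPlane.

Lemma cnormN s : cnorm (- s) = cnorm s.
Proof. by congr sqrt; apply: eq_bigr => A _; rewrite ffunE sqrrN. Qed.

End Clifford.

(** * The Euclidean norm and the geometry of double sectors *)

Section Sectors.
Variable n : nat.
Implicit Types (s t J : cliff R n) (om : R).

Lemma sum_sqr_ge0 (I : finType) (a : I -> R) :
  0 <= (\sum_i a i ^+ 2)%R.
Proof.
by apply/RleP; apply: Num.Theory.sumr_ge0 => i _; apply: Num.Theory.sqr_ge0.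
Qed.

Lemma Cauchy_Schwarz_sum (I : finType) (a b : I -> R) :
  (\sum_i a i * b i)%R <=
  sqrt (\sum_i a i ^+ 2)%R * sqrt (\sum_i b i ^+ 2)%R.
Proof.
set C := (\sum_i a i * b i)%R.
set A := (\sum_i a i ^+ 2)%R; set B := (\sum_i b i ^+ 2)%R.
have A0 : 0 <= A := sum_sqr_ge0 a; have B0 : 0 <= B := sum_sqr_ge0 b.
have pos k : 0 <= A - 2 * k * C + k * k * B.
  suff <- : (\sum_i (a i - k * b i) ^+ 2)%R = A - 2 * k * C + k * k * B.
    exact: sum_sqr_ge0.
  rewrite /A /B /C RplusE RminusE !RmultE !GRing.mulr_sumr -GRing.sumrB -big_split /=.
  apply: eq_bigr => i _; rewrite !GRing.expr2 -?RminusE -?RplusE -?RoppE -?RmultE.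
  by ring.
rewrite -sqrt_mult //; apply: Rle_trans (Rle_abs _) _.
rewrite -sqrt_Rsqr_abs; apply: sqrt_le_1_alt; rewrite /Rsqr.
have [Bz|Bp] : B = 0 \/ 0 < B by lra.
  have [->|C0] := Req_dec C 0; first by rewrite Bz; lra.
  (* For [B = 0] the quadratic is affine in [k], and this [k] would give it the negative value
     [A - 2 * (A + 1)]. *)
  have := pos ((A + 1) / C); rewrite Bz Rmult_0_r.
  have -> : 2 * ((A + 1) / C) * C = 2 * (A + 1) by field.
  by lra.
(* The minimiser of the quadratic. *)
have := pos (C / B).
have -> : A - 2 * (C / B) * C + C / B * (C / B) * B = A - C * C / B by field; lra.
move=> H; have : C * C / B <= A by lra.
move/(Rmult_le_compat_r B _ _ B0); have -> : C * C / B * B = C * C by field; lra.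
by [].
Qed.

Lemma cnorm_ge0 s : 0 <= cnorm s. Proof. exact: sqrt_pos. Qed.

Lemma cnorm_sqr s : cnorm s * cnorm s = (\sum_A s A ^+ 2)%R.
Proof. by apply: sqrt_sqrt; apply: sum_sqr_ge0. Qed.

Lemma cnorm_triangle s t : cnorm (GRing.add s t) <= cnorm s + cnorm t.
Proof.
have H := Cauchy_Schwarz_sum s t.
have := cnorm_sqr (GRing.add s t).
have -> : (\sum_A (GRing.add s t) A ^+ 2)%R =
    (\sum_A s A ^+ 2)%R + 2 * (\sum_A s A * t A)%R + (\sum_A t A ^+ 2)%R.
  rewrite !RplusE !RmultE GRing.mulr_sumr -!big_split /=; apply: eq_bigr => A _.
  have E (x y : R) : (x + y) * (x + y) = x * x + 2 * (x * y) + y * y by ring.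
  by rewrite ffunE !GRing.expr2; apply: E.
rewrite -!cnorm_sqr => E; apply: Rsqr_incr_0_var; last first.
  by have := cnorm_ge0 s; have := cnorm_ge0 t; lra.
move: H; rewrite /Rsqr E -/(cnorm s) -/(cnorm t).
set c : R := bigop.body _ _ _; move: (cnorm s) (cnorm t) c => x y c; lra.
Qed.

Lemma Rabs_Sc_le s : Rabs (Sc s) <= cnorm s.
Proof.
rewrite -sqrt_Rsqr_abs; apply: sqrt_le_1_alt; rewrite (bigD1 set0) //= /Rsqr.
set S := (X in GRing.add _ X).
have : 0 <= S.
  by apply/RleP; apply: Num.Theory.sumr_ge0 => i _; apply: Num.Theory.sqr_ge0.
have E (x y : R) : 0 <= y -> x * x <= x * x + y by lra.
by move=> S0; rewrite /Sc GRing.expr2; apply: E.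
Qed.

Lemma ScN s : Sc (GRing.opp s) = - Sc s.
Proof. by rewrite /Sc ffunE. Qed.

Lemma cnorm_eq0 s : cnorm s = 0 -> s = 0%R.
Proof.
move=> s0; have := cnorm_sqr s; rewrite s0 Rmult_0_l => /esym/eqP.
rewrite Num.Theory.psumr_eq0; last by move=> A _; apply: Num.Theory.sqr_ge0.
move/allP => H; apply/ffunP => A; rewrite ffunE; apply/eqP.
by have := H A (mem_index_enum _); rewrite GRing.sqrf_eq0.
Qed.

Lemma cnorm_gt0 s : s <> 0%R -> 0 < cnorm s.
Proof.
by move=> s0; have [//|] := cnorm_ge0 s => /esym/cnorm_eq0.
Qed.

Lemma acos_lt x om : -1 <= x <= 1 -> 0 < om < PI -> acos x < om <-> cos om < x.
Proof.
move=> x1 om1; have [a0 a1] := acos_bound x; split=> H.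
  by rewrite -[X in _ < X](cos_acos _ x1); apply: cos_decreasing_1; lra.
apply: Rnot_le_lt => le; have : x <= cos om; last lra.
by rewrite -{1}(cos_acos _ x1); apply: cos_decr_1; lra.
Qed.

(** Cosine decreases on [[0, PI]], which turns the condition on the angle into a polynomial one on
    [Sc s] and [cnorm s]. *)
Lemma sectorE om s : 0 < om < PI / 2 -> paravector s -> s <> 0%R ->
  sector om s <-> cos om * cnorm s < Sc s.
Proof.
move=> om1 ps s0; have s1 := cnorm_gt0 s0; have := Rabs_Sc_le s => sc.
have x1 : -1 <= Sc s / cnorm s <= 1.
  split; apply: (Rmult_le_reg_r (cnorm s)) => //;
  rewrite /Rdiv Rmult_assoc Rinv_l; split_Rabs; lra.
have om2 : 0 < om < PI by lra.
have [a0 a1] := acos_bound (Sc s / cnorm s).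
have E : cos om < Sc s / cnorm s <-> cos om * cnorm s < Sc s.
  split=> H.
    have := Rmult_lt_compat_r _ _ _ s1 H.
    by rewrite /Rdiv Rmult_assoc Rinv_l; lra.
  apply: (Rmult_lt_reg_r (cnorm s)) => //.
  by rewrite /Rdiv Rmult_assoc Rinv_l; lra.
rewrite -E -(acos_lt x1 om2) /sector /Arg Rabs_pos_eq //.
by split; [case|].
Qed.

Lemma paravectorN s : paravector s -> paravector (GRing.opp s).
Proof.
case=> x0 [x ->]; exists (- x0), (fun i => - x i).
rewrite GRing.opprD -GRing.scaleNr -GRing.sumrN; congr GRing.add.
by apply: eq_bigr => i _; rewrite -GRing.scaleNr.
Qed.

Lemma double_sectorE om s : 0 < om < PI / 2 -> paravector s -> s <> 0%R ->
  double_sector om s <-> cos om * cnorm s < Rabs (Sc s).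
Proof.
move=> om1 ps s0; rewrite /double_sector sectorE // sectorE //; last first.
- by move=> /(congr1 GRing.opp); rewrite GRing.opprK GRing.oppr0.
- exact: paravectorN.
rewrite cnormN ScN; have := cnorm_gt0 s0.
have : 0 < cos om by apply: cos_gt_0; lra.
move=> c s1; have := Rmult_lt_0_compat _ _ c s1.
by split_Rabs; lra.
Qed.

(** Both sides are 1-Lipschitz in [s], so a violation with gap [2 * e] would persist at points
    closer than [e], among which are points of the double sector. *)
Lemma para_closure_double_sector om s : 0 < om < PI / 2 ->
  para_closure (double_sector om) s -> cos om * cnorm s <= Rabs (Sc s).
Proof.
move=> om1 [ps H]; apply: Rnot_lt_le => lt.
pose e := (cos om * cnorm s - Rabs (Sc s)) / 2.
have e0 : 0 < e by rewrite /e; lra.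
have [t Dt st] := H e e0.
have [pt t0] : paravector t /\ t <> 0%R.
  case: Dt => [[? ? _] //|[pt t0 _]]; split.
    by rewrite -[t]GRing.opprK; apply: paravectorN.
  by move=> tz; apply: t0; rewrite tz GRing.oppr0.
move: Dt; rewrite double_sectorE // => Dt.
have := Rabs_Sc_le (GRing.add s (GRing.opp t)).
have -> : Sc (GRing.add s (GRing.opp t)) = Sc s - Sc t by rewrite ScD ScN.
have : cnorm s <= cnorm (GRing.add s (GRing.opp t)) + cnorm t.
  by rewrite -{1}[s](GRing.subrK t); apply: cnorm_triangle.
move=> H1 H2; have c0 : 0 < cos om by apply: cos_gt_0; lra.
have c1 := COS_bound om.
have H3 := Rmult_le_compat_l _ _ _ (Rlt_le _ _ c0) H1.
have : cos om * cnorm (GRing.add s (GRing.opp t)) < e.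
  by have := cnorm_ge0 (GRing.add s (GRing.opp t)); nra.
move: H2 H3; rewrite Rmult_plus_distr_l /e.
by move: st; rewrite /e; split_Rabs; lra.
Qed.

End Sectors.

(** * The real inner product and the action of a complex plane on the module *)

Section HilbertModule.
Context {n : nat} {V : rightHilbertModule n}.
Implicit Types (u v w z : V) (s J : cliff R n).

Definition inner z v : R := Sc (Defs.form z v).

Lemma inner_plus z v w : inner z (plus v w) = inner z v + inner z w.
Proof. by rewrite /inner Defs.formDr ScD. Qed.

Lemma inner_scal z x v : inner z (scal x v) = x * inner z v.
Proof. by rewrite /inner Defs.formZr ScZ. Qed.

Lemma inner_opp z v : inner z (opp v) = - inner z v.
Proof. by rewrite -scal_opp_one inner_scal /= /opp /one /=; lra. Qed.

Lemma inner_minus z v w : inner z (minus v w) = inner z v - inner z w.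
Proof. by rewrite /minus inner_plus inner_opp. Qed.

Lemma inner_zero z : inner z zero = 0.
Proof. by rewrite -(scal_zero_l (V := V) zero) inner_scal; apply: Rmult_0_l. Qed.

Definition innerE :=
  (inner_plus, inner_minus, inner_scal, inner_opp, inner_zero).

Lemma norm_sqr v : norm v * norm v = inner v v.
Proof. by rewrite /inner -norm_form GRing.expr2. Qed.

(* Reduces an equation between linear combinations in V to one in R, within
   the reach of lra. *)
Lemma inner_ext v w : (forall z, inner z v = inner z w) -> v = w.
Proof.
move=> H; have N : norm (minus v w) * norm (minus v w) = 0.
  by rewrite norm_sqr inner_minus H; lra.
have N0 : norm (minus v w) = 0 by case: (Rmult_integral _ _ N).
have := norm_eq_zero _ N0 => E.
by rewrite -(plus_zero_l w) -E /minus -plus_assoc plus_opp_l plus_zero_r.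
Qed.

Lemma act_scall x v s : act (scal x v) s = scal x (act v s).
Proof.
rewrite -!act_scal -!actM.
by rewrite -GRing.scalerAl GRing.mul1r -GRing.scalerAr GRing.mulr1.
Qed.

Lemma act_scalr x v s : act v (GRing.scale x s) = scal x (act v s).
Proof. by rewrite -act_scal -actM -GRing.scalerAr GRing.mulr1. Qed.

Lemma act_oppl v s : act (opp v) s = opp (act v s).
Proof. by rewrite -(scal_opp_one v) -(scal_opp_one (act v s)) act_scall. Qed.

Lemma act_minusl v w s : act (minus v w) s = minus (act v s) (act w s).
Proof. by rewrite /minus actDl act_oppl. Qed.

Lemma act_cplane J v x y :
  act v (cplane J x y) = plus (scal x v) (scal y (act v J)).
Proof. by rewrite actDr act_scal act_scalr. Qed.

Section ComplexStructure.
Variable J : cliff R n.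
Hypothesis J_imag : imag_sphere J.

Lemma act_imag2 v : act (act v J) J = opp v.
Proof.
by rewrite -actM imag_sphere_sqr // -GRing.scaleN1r act_scal scal_opp_one.
Qed.

(** Since [Sc] is a trace, [Sc (conjug s * (form v v * s))] is [Sc (form v v * (s * conjug s))], and
    [s * conjug s] is real for [s] in a complex plane. *)
Lemma norm_act v x y :
  norm (act v (cplane J x y)) = sqrt (x * x + y * y) * norm v.
Proof.
apply: Rsqr_inj; [exact: norm_ge_0|by apply: Rmult_le_pos (sqrt_pos _) (norm_ge_0 _)|].
rewrite Rsqr_mult Rsqr_sqrt; last nra.
rewrite /Rsqr !norm_sqr /inner form_actl form_actr Sc_mulC -GRing.mulrA.
rewrite conjug_cplane //.
rewrite cplaneM // -[X in GRing.mul _ X]/(cplane _ _ _).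
have -> : x * - y + y * x = 0 by lra.
rewrite -cplane_real -GRing.scalerAr GRing.mulr1 ScZ -RmultE; congr Rmult; lra.
Qed.

Lemma act_cplane_linear x y : is_linear (fun v : V => act v (cplane J x y)).
Proof.
split=> [v w|k v|]; [exact: actDl|exact: act_scall|].
(* [is_linear] asks for a positive bound, hence the added 1. *)
exists (sqrt (x * x + y * y) + 1); split.
  by have := sqrt_pos (x * x + y * y); lra.
by move=> v; rewrite norm_act; have := norm_ge_0 v; nra.
Qed.

End ComplexStructure.
End HilbertModule.

Ltac vector := apply: inner_ext => ?; rewrite ?innerE; lra.

(** * Right linear operators given by graphs *)

Section RightLinear.
Context {n : nat} {V : rightHilbertModule n}.
Variable T : operator V.
Hypothesis T_lin : right_linear T.
Implicit Types u v w : V.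

Lemma right_linear_fun v w w' : T v w -> T v w' -> w = w'.
Proof. by case: T_lin => H _ _ _; apply: H. Qed.

Lemma right_linear_plus v w v' w' :
  T v w -> T v' w' -> T (plus v v') (plus w w').
Proof. by case: T_lin => _ _ H _; apply: H. Qed.

Lemma right_linear_act v w s : T v w -> T (act v s) (act w s).
Proof. by case: T_lin => _ _ _; apply. Qed.

Lemma right_linear_scal v w x : T v w -> T (scal x v) (scal x w).
Proof. by rewrite -!act_scal; apply: right_linear_act. Qed.

Lemma right_linear_minus v w v' w' :
  T v w -> T v' w' -> T (minus v v') (minus w w').
Proof.
move=> H H'; apply: right_linear_plus => //.
by rewrite -(scal_opp_one v') -(scal_opp_one w'); apply: right_linear_scal.
Qed.

End RightLinear.

(** * The resolvent in terms of the inverse of [Q] *)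

Section Resolvent.
Local Open Scope R_scope.
Context {n : nat} {V : rightHilbertModule n}.
Variables (T : operator V) (J : cliff R n).
Hypothesis T_lin : right_linear T.
Hypothesis J_imag : imag_sphere J.
Implicit Types (u v w : V) (s : cliff R n) (x y : R).

Lemma Q_cplane x y u v : Q (cplane J x y) T u v <->
  exists u1 u2, [/\ T u u1, T u1 u2 &
    v = plus (minus u2 (scal (2 * x) u1)) (scal (x * x + y * y) u)].
Proof.
rewrite /Q cnorm_cplane // Sc_cplane // GRing.expr2.
have E : (sqrt (x * x + y * y) * sqrt (x * x + y * y) = x * x + y * y)%R.
  by apply: sqrt_sqrt; nra.
by rewrite E.
Qed.

(** [s - T] after [conj s - T] is [Q_s]: right multiplications commute with [T], and [s + conj s]
    and [s * conj s] are real. Hence the resolvent is [conj s - T] applied after the inverse of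
    [Q_s]. *)
Lemma Q_resolvent x y u u1 v : Q (cplane J x y) T u v -> T u u1 ->
  resolvent (cplane J x y) T v (minus (act u (cplane J x (- y))) u1).
Proof.
rewrite Q_cplane => -[u1' [u2 [Tu Tu1 ->]]] Tu1'.
rewrite (right_linear_fun T_lin Tu1' Tu) {u1 Tu1'}; move: u1' Tu Tu1 => u1 Tu Tu1.
exists (minus (act u1 (cplane J x (- y))) u2).
  by apply: right_linear_minus => //; apply: right_linear_act.
rewrite !act_cplane !act_minusl !actDl !act_scall act_imag2 //.
by vector.
Qed.

(** If [T w = w s], then [Q_s w = w (s^2 - 2 s_0 s + |s|^2) = 0]. This transfers injectivity from
    [Q_s] to [s - T]. *)
Lemma resolvent_Q x y w : resolvent (cplane J x y) T zero w ->
  Q (cplane J x y) T w zero.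
Proof.
case=> u Tw E; have {}E : u = act w (cplane J x y).
  by apply: inner_ext => z; have := congr1 (inner z) E; rewrite !innerE; lra.
rewrite Q_cplane; exists u, (act u (cplane J x y)); split => //.
  by rewrite {1}E; apply: right_linear_act.
rewrite E !act_cplane !actDl !act_scall act_imag2 //.
by vector.
Qed.

End Resolvent.

(** * The resolvent of a bisectorial operator along a ray *)

Section BisectorialResolvent.
Context {n : nat} {V : rightHilbertModule n}.
Variables (T : operator V) (omega : R).
Hypothesis T_bis : bisectorial omega T.
Implicit Types (u v w : V) (s J : cliff R n) (x y c t r : R).

Let T_lin : right_linear T. Proof. by case: T_bis => _ []. Qed.

(** The inclusion of [L T] in [T L], the usual commutation with an unbounded operator; it includes
    that [L] preserves the domain of [T]. *)
Definition commutes (L : V -> V) := forall v w, T v w -> T (L v) (L w).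

Let omega_pi2 : 0 < omega < PI / 2. Proof. by case: T_bis. Qed.

Let cos_omega : 0 < cos omega. Proof. by apply: cos_gt_0; lra. Qed.

(** The unit vector [c + J t] lies outside the closed double sector of angle [omega] and off the
    imaginary axis, so its angle is admissible in the resolvent estimate of [bisectorial]. *)
Definition direction c t := c * c + t * t = 1 /\ 0 < Rabs c < cos omega.

Definition res s v : V := iota (resolvent s T v).

Section Direction.
Variables (J : cliff R n) (c t : R).
Hypothesis J_imag : imag_sphere J.
Hypothesis ct : direction c t.

Definition ray r := cplane J (r * c) (r * t).

Lemma cnorm_ray r : 0 < r -> cnorm (ray r) = r.
Proof.
move=> r0; rewrite cnorm_cplane //.
have -> : r * c * (r * c) + r * t * (r * t) = r * r * (c * c + t * t) by ring.
by rewrite (proj1 ct) Rmult_1_r sqrt_square //; lra.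
Qed.

Lemma Sc_ray r : Sc (ray r) = r * c. Proof. exact: Sc_cplane. Qed.

Lemma Rabs_Sc_ray r : 0 < r -> Rabs (Sc (ray r)) = r * Rabs c.
Proof. by move=> r0; rewrite Sc_ray Rabs_mult (Rabs_pos_eq r) //; lra. Qed.

Lemma ray_neq0 r : 0 < r -> ray r <> 0%R.
Proof.
move=> r0 E; have : cnorm (ray r) = cnorm (0%R : cliff R n) by rewrite E.
rewrite cnorm_ray // /cnorm big1 ?sqrt_0; first lra.
by move=> A _; rewrite ffunE GRing.expr0n.
Qed.

(** On the spectrum [cos omega * cnorm s <= Rabs (Sc s)], which fails on the ray. *)
Lemma ray_rho r : 0 < r -> bounded_op (op_inv (Q (ray r) T)).
Proof.
move=> r0; apply: NNPP => H; case: T_bis => _ _ sig _.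
have : sigma_S T (ray r).
  by split; [exact: paravector_cplane|case].
move/sig/(para_closure_double_sector omega_pi2).
rewrite cnorm_ray // Rabs_Sc_ray //; have := proj2 ct; nra.
Qed.

Lemma Q_ex r v : 0 < r -> exists u, Q (ray r) T u v.
Proof. by move=> r0; case: (ray_rho r0) => _ /(_ v). Qed.

Lemma resolvent_ex r v : 0 < r -> exists w, resolvent (ray r) T v w.
Proof.
move=> r0; have [u Qu] := Q_ex v r0; case: (Qu) => u1 [_ [Tu _ _]].
by eexists; apply: Q_resolvent Qu Tu.
Qed.

(** The difference is annihilated by [s - T], hence by [Q_s] through [resolvent_Q], and the inverse
    of [Q_s] is single-valued. *)
Lemma resolvent_fun r v w w' : 0 < r ->
  resolvent (ray r) T v w -> resolvent (ray r) T v w' -> w = w'.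
Proof.
move=> r0 [u Tu E] [u' Tu' E'].
have H : resolvent (ray r) T zero (minus w w').
  exists (minus u u'); first exact: right_linear_minus.
  rewrite act_minusl; apply: inner_ext => z; rewrite !innerE.
  by have := congr1 (inner z) E; have := congr1 (inner z) E'; rewrite !innerE; lra.
have {}H := resolvent_Q T_lin J_imag H.
case: (ray_rho r0) => -[qf q0 _ _] _ _.
have := qf zero _ _ H q0 => {}H.
by apply: inner_ext => z; have := congr1 (inner z) H; rewrite !innerE; lra.
Qed.

Lemma resP r v : 0 < r -> resolvent (ray r) T v (res (ray r) v).
Proof.
move=> r0; apply: iota_correct; have [w rw] := resolvent_ex v r0.
by exists w; split => // w' rw'; apply: resolvent_fun rw rw'.
Qed.

Lemma res_eq r v w : 0 < r -> resolvent (ray r) T v w -> res (ray r) v = w.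
Proof. by move=> r0; apply: resolvent_fun => //; apply: resP. Qed.

(** The ray lies on the boundary of the open double sector of angle [acos (Rabs c)], hence outside
    it, so this angle can serve as [phi] in the resolvent estimate. *)
Lemma res_bound : exists2 C, 0 <= C &
  forall r v, 0 < r -> norm (res (ray r) v) <= C / r * norm v.
Proof.
have [ct1 [c0 c1]] := ct.
have c2 : -1 <= Rabs c <= 1 by have := COS_bound omega; lra.
have a1 : omega < acos (Rabs c).
  apply: Rnot_le_lt => le; have : cos omega <= Rabs c; last lra.
  rewrite -[X in _ <= X](cos_acos _ c2); have [] := acos_bound (Rabs c) => a0 a1.
  by apply: cos_decr_1; lra.
have a2 : acos (Rabs c) < PI / 2.
  by apply/acos_lt => //; [lra|rewrite cos_PI2].
case: T_bis => _ _ _ /(_ _ (conj a1 a2)) [C C0 HC]; exists C => // r v r0.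
rewrite -{2}(cnorm_ray r0).
apply: (HC (ray r)); [exact: paravector_cplane|exact: ray_neq0| |exact: resP].
rewrite double_sectorE; [|lra|exact: paravector_cplane|exact: ray_neq0].
by rewrite cos_acos // cnorm_ray // Rabs_Sc_ray //; lra.
Qed.

Lemma res_plus r v w : 0 < r ->
  res (ray r) (plus v w) = plus (res (ray r) v) (res (ray r) w).
Proof.
move=> r0; apply: res_eq => //.
have [u Tu E] := resP v r0; have [u' Tu' E'] := resP w r0.
exists (plus u u'); first exact: right_linear_plus.
rewrite {1}E {1}E' actDl; vector.
Qed.

Lemma res_act r v x y : 0 < r ->
  res (ray r) (act v (cplane J x y)) = act (res (ray r) v) (cplane J x y).
Proof.
move=> r0; apply: res_eq => //; have [u Tu E] := resP v r0.
exists (act u (cplane J x y)); first exact: right_linear_act.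
rewrite {1}E act_minusl; congr minus.
by rewrite -!actM !cplaneM //; congr (act _ (cplane _ _ _)); ring.
Qed.

Lemma res_linear r : 0 < r -> is_linear (res (ray r)).
Proof.
move=> r0; split=> [v w|x v|]; first exact: res_plus.
- by have := res_act v x 0 r0; rewrite -cplane_real !act_scal.
have [C C0 HC] := res_bound; exists (C / r + 1); split.
  have : 0 < / r by apply: Rinv_0_lt_compat.
  by rewrite /Rdiv; nra.
by move=> v; have := HC r v r0; have := norm_ge_0 v; lra.
Qed.

Lemma res_commutes r : 0 < r -> commutes (res (ray r)).
Proof.
move=> r0 v w Tv; have [u Tu E] := resP v r0.
(* Here [u = T (res v) = (res v) s - v]; applying [T] gives [T u = u s - w], so [u] is the resolvent
   at [w]. *)
suff -> : res (ray r) w = u by [].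
apply: res_eq => //.
have Eu : minus (act (res (ray r) v) (ray r)) v = u.
  by apply: inner_ext => z; have := congr1 (inner z) E; rewrite !innerE; lra.
exists (minus (act u (ray r)) w); last by vector.
by rewrite -{1}Eu; apply: right_linear_minus => //; apply: right_linear_act.
Qed.

(** The resolvent identity, with [s' - s] in coordinates: for [w = res s' v], the vector [v] is
    [w (s' - s)] plus the image of [w] under [s - T]. *)
Lemma res_sub r r' v : 0 < r -> 0 < r' ->
  minus (res (ray r) v) (res (ray r') v) =
  res (ray r) (act (res (ray r') v) (cplane J ((r' - r) * c) ((r' - r) * t))).
Proof.
move=> r0 r'0; set w := res (ray r') v; have [u Tu E] := resP v r'0.
set d := act w _.
have -> : res (ray r) v = plus w (res (ray r) d).
  have -> : v = plus (minus v d) d by vector.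
  rewrite res_plus //; congr plus.
  apply: res_eq => //.
  exists u => //; rewrite {1}E /d /ray !act_cplane -/w; vector.
vector.
Qed.

Lemma res_continuous r v : 0 < r -> continuous (fun r => res (ray r) v) r.
Proof.
move=> r0; have [C C0 HC] := res_bound.
(* The resolvent identity gives a Lipschitz bound near [r]; staying above [r / 2] makes the constant
   independent of [r']. *)
have bnd r' : r / 2 < r' ->
    norm (minus (res (ray r) v) (res (ray r') v)) <=
    C / r * (C / (r / 2) * norm v) * Rabs (r' - r).
  move=> rr; have r'0 : 0 < r' by lra.
  rewrite res_sub //; apply: Rle_trans (HC _ _ r0) _; rewrite Rmult_assoc.
  apply: Rmult_le_compat_l.
    by apply: Rmult_le_pos => //; apply: Rlt_le; apply: Rinv_0_lt_compat.
  rewrite norm_act //.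
  have -> : (r' - r) * c * ((r' - r) * c) + (r' - r) * t * ((r' - r) * t) =
     Rsqr (r' - r) * (c * c + t * t) by rewrite /Rsqr; ring.
  rewrite (proj1 ct) Rmult_1_r sqrt_Rsqr_abs Rmult_comm.
  apply: Rmult_le_compat_r (Rabs_pos _) _; apply: Rle_trans (HC _ _ r'0) _.
  apply: Rmult_le_compat_r (norm_ge_0 _) _.
  by apply: Rmult_le_compat_l => //; apply: Rinv_le_contravar; lra.
set K := C / r * (C / (r / 2) * norm v) in bnd.
apply/filterlim_locally => eps.
have K0 : 0 <= K.
  apply: Rmult_le_pos; [|apply: Rmult_le_pos (norm_ge_0 _)];
  by apply: Rmult_le_pos => //; apply: Rlt_le; apply: Rinv_0_lt_compat; lra.
have d0 : 0 < Rmin (r / 2) (eps / (K + 1)).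
  by apply: Rmin_pos; [lra|apply: Rdiv_lt_0_compat; [exact: cond_pos|lra]].
exists (mkposreal _ d0) => r' /=.
rewrite /ball /= /AbsRing_ball /abs /minus /plus /opp /= => rr'.
have [rr1 rr2] : Rabs (r' - r) < r / 2 /\ Rabs (r' - r) < eps / (K + 1).
  by split; apply: Rlt_le_trans rr' _; [apply: Rmin_l|apply: Rmin_r].
apply: ball_sym; apply: norm_compat1.
apply: Rle_lt_trans (bnd r' _) _; first by split_Rabs; lra.
have : (K + 1) * Rabs (r' - r) < eps.
  have -> : (eps : R) = (K + 1) * (eps / (K + 1)) by field; lra.
  by apply: Rmult_lt_compat_l => //; lra.
by have := Rabs_pos (r' - r); nra.
Qed.

End Direction.
End BisectorialResolvent.

(** * The integrable majorant given by the decay of functions in [N0] *)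

Section PowerMajorant.

Lemma filterlim_Rpower_0 a : 0 < a ->
  filterlim (fun r => Rpower r a) (at_right 0) (locally 0).
Proof.
move=> a0; apply: (filterlim_comp _ _ _ ln (fun y => exp (a * y)) _
  (Rbar_locally m_infty)); first exact: is_lim_ln_0.
apply: (filterlim_comp _ _ _ (Rmult a) exp _ (Rbar_locally m_infty)).
  have := filterlim_Rbar_mult_l a m_infty.
  by rewrite /Rbar_mult /=; case: Rle_dec => [H|]; [case: Rle_lt_or_eq_dec => //|]; lra.
exact: is_lim_exp_m.
Qed.

Lemma filterlim_Rpower_p a : 0 < a ->
  filterlim (fun r => Rpower r a) (Rbar_locally p_infty) (Rbar_locally p_infty).
Proof.
move=> a0; apply: (filterlim_comp _ _ _ ln (fun y => exp (a * y)) _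
  (Rbar_locally p_infty)); first exact: is_lim_ln_p.
apply: (filterlim_comp _ _ _ (Rmult a) exp _ (Rbar_locally p_infty)).
  have := filterlim_Rbar_mult_l a p_infty.
  by rewrite /Rbar_mult /=; case: Rle_dec => [H|]; [case: Rle_lt_or_eq_dec => //|]; lra.
exact: is_lim_exp_p.
Qed.

Variables (V : CompleteNormedModule R_AbsRing) (h : R -> V) (a K : R).
Hypotheses (a0 : 0 < a) (K0 : 0 <= K).
Hypothesis h_cont : forall r, 0 < r -> continuous h r.
Hypothesis h_le : forall r, 0 < r ->
  norm (h r) <= K * (Rpower r a / (1 + Rpower r (2 * a)) / r).

(* With y = r^a, y / (1 + y^2) <= 2 y / (1 + y)^2, and 2 y / (1 + y)^2 / r is
   the derivative of - (2 / a) / (1 + y). *)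
Lemma is_RInt_gen_power :
  exists2 l, is_RInt_gen h (at_right 0) (Rbar_locally p_infty) l
    & norm l <= K * (2 / a).
Proof.
pose y r := Rpower r a; pose g r := K * (2 * y r / (1 + y r) ^ 2 / r).
pose G r := - (K * (2 / a)) * / (1 + y r).
have y0 r : 0 < y r by apply: exp_pos.
have y_der r : 0 < r -> is_derive y r (a * y r / r).
  move=> r0; rewrite /y /Rpower; auto_derive => //; by field; lra.
have := @is_RInt_gen_dominated V h g G (- (K * (2 / a))) 0 h_cont.
have -> : 0 - - (K * (2 / a)) = K * (2 / a) by ring.
apply.
- move=> r r0; apply: ex_derive_continuous; rewrite /g /y /Rpower; auto_derive.
  have := y0 r; rewrite /y /Rpower => yr; repeat split => //; try lra.
  by apply: Rgt_not_eq; nra.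
- move=> r r0; have yr := y0 r; have D := y_der r r0.
  have -> : g r = - (K * (2 / a)) * (- (a * y r / r) / (1 + y r) ^ 2).
    by rewrite /g; field; lra.
  apply: is_derive_scal; apply: is_derive_inv; last lra.
  have := is_derive_plus (fun _ : R => 1) y r _ _ (is_derive_const 1 r) D.
  by rewrite plus_zero_l.
- move=> r r0; apply: Rle_trans (h_le r0) _; apply: Rmult_le_compat_l => //.
  apply: Rmult_le_compat_r; first by apply: Rlt_le; apply: Rinv_0_lt_compat.
  have -> : Rpower r (2 * a) = y r * y r.
    by rewrite /y -Rpower_plus; congr Rpower; ring.
  rewrite -/(y r); have yr := y0 r.
  apply: (Rmult_le_reg_r ((1 + y r * y r) * (1 + y r) ^ 2)); first by nra.
  have -> : y r / (1 + y r * y r) * ((1 + y r * y r) * (1 + y r) ^ 2) =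
     y r * (1 + y r) ^ 2 by field; nra.
  have -> : 2 * y r / (1 + y r) ^ 2 * ((1 + y r * y r) * (1 + y r) ^ 2) =
     2 * y r * (1 + y r * y r) by field; nra.
  by have := Rmult_le_pos _ _ (Rlt_le _ _ yr) (Rle_0_sqr (1 - y r)); rewrite /Rsqr; lra.
- apply: (filterlim_comp _ _ _ y (fun y => - (K * (2 / a)) * / (1 + y)) _ (locally 0)).
    exact: filterlim_Rpower_0.
  have : continuous (fun y => - (K * (2 / a)) * / (1 + y)) 0.
    by apply: ex_derive_continuous; auto_derive; lra.
  by rewrite /continuous Rplus_0_r Rinv_1 Rmult_1_r.
- apply: (filterlim_comp _ _ _ y (fun y => - (K * (2 / a)) * / (1 + y)) _
    (Rbar_locally p_infty)).
    exact: filterlim_Rpower_p.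
  have H : is_lim (fun y => - (K * (2 / a)) * / (1 + y)) p_infty
      (Rbar_mult (- (K * (2 / a))) 0).
    apply: is_lim_scal_l; apply: (is_lim_inv _ _ p_infty) => //.
    by apply: is_lim_plus; [apply: is_lim_const|apply: is_lim_id|].
  by move: H; rewrite /= Rmult_0_r.
Qed.

End PowerMajorant.

(** * Intrinsic functions along a ray and its conjugate *)

Section IntrinsicFunctions.
Context {n : nat}.
Variables (J : cliff R n) (theta : R).
Hypothesis J_imag : imag_sphere J.
Hypothesis theta_pi2 : 0 < theta < PI / 2.
Implicit Types (x y c t r : R) (f : cliff R n -> cliff R n).

Lemma double_sector_cplane x y : double_sector theta (cplane J x y) <->
  cos theta * sqrt (x * x + y * y) < Rabs x.
Proof.
have [E|N] := classic (cplane J x y = 0%R).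
  have x0 : x = 0 by rewrite -(Sc_cplane J_imag x y) E /Sc ffunE.
  split=> [[] []|]; rewrite ?E ?GRing.oppr0 //.
  rewrite x0 Rabs_R0 Rmult_0_l Rplus_0_l => H.
  have := cos_gt_0 theta; have := sqrt_pos (y * y); nra.
rewrite double_sectorE //; last exact: paravector_cplane.
by rewrite cnorm_cplane // Sc_cplane.
Qed.

Lemma open_double_sector_cplane x y : double_sector theta (cplane J x y) ->
  locally (x, y) (fun p => double_sector theta (cplane J p.1 p.2)).
Proof.
rewrite double_sector_cplane => H.
pose phi (p : R * R) := minus (Rabs p.1)
  (scal (cos theta) (sqrt (plus (scal p.1 p.1) (scal p.2 p.2)))).
have C : continuous phi (x, y).
  have C1 : continuous (fun p : R * R => p.1) (x, y) by exact: continuous_fst.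
  have C2 : continuous (fun p : R * R => p.2) (x, y) by exact: continuous_snd.
  apply: (continuous_minus (V := R_NormedModule)).
    exact: (continuous_comp _ Rabs _ C1 (continuous_Rabs _)).
  apply: (continuous_scal_r (V := R_NormedModule)).
  apply: (continuous_comp _ sqrt); last exact: continuous_sqrt.
  by apply: (continuous_plus (V := R_NormedModule));
    apply: (continuous_scal (V := R_NormedModule)).
have phi0 : 0 < phi (x, y).
  by rewrite /phi /minus /plus /opp /scal /= /mult /=; lra.
have HC : locally (x, y) (fun p => 0 < phi p) := C _ (open_gt 0 _ phi0).
apply: filter_imp HC => -[x' y'].
rewrite /phi /minus /plus /opp /scal /= /mult /= => H'.
by apply/double_sector_cplane; lra.
Qed.

(** Partial derivatives that exist nearby and are continuous make [g] differentiable, hence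
    continuous. *)
Lemma C1_continuous (U : R * R -> Prop) (g gx gy : R -> R -> R) x y :
  locally (x, y) U -> (forall u v, U (u, v) -> C1_at g gx gy u v) ->
  continuous (fun p : R * R => g p.1 p.2) (x, y).
Proof.
move=> LU H; have [_ Dy Cx _] := H _ _ (locally_singleton _ _ LU).
apply: filterdiff_continuous; eexists.
apply: (is_derive_filterdiff g x y gx _ _ Dy).
  by apply: filter_imp LU => -[u v] /H [D _ _ _]; exact: D.
exact/continuity_2d_pt_filterlim.
Qed.

(** As [alpha] is even and [beta] odd in the imaginary coordinate, the same [a] and [b] describe [f]
    on both conjugate rays. *)
Lemma intrinsic_ray f c t : intrinsic (double_sector theta) f ->
  c * c + t * t = 1 -> cos theta < Rabs c ->
  exists a b : R -> R, forall r, 0 < r ->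
  [/\ f (ray J c t r) = cplane J (a r) (b r),
      f (ray J c (- t) r) = cplane J (a r) (- b r),
      continuous a r & continuous b r].
Proof.
case=> al [be [al_x [al_y [be_x [be_y H]]]]] ct1 c1.
exists (fun r => al (r * c) (r * t)), (fun r => be (r * c) (r * t)) => r r0.
have U t' : t' * t' = t * t -> double_sector theta (cplane J (r * c) (r * t')).
  move=> tt; apply/double_sector_cplane.
  have -> : r * c * (r * c) + r * t' * (r * t') = r * r * (c * c + t' * t') by ring.
  rewrite tt ct1 Rmult_1_r sqrt_square; last lra.
  by rewrite Rabs_mult (Rabs_pos_eq r); [nra|lra].
have Ut := U t erefl; have Uo := open_double_sector_cplane Ut.
have [E _ _ [Ea Eb]] := H _ _ _ J_imag Ut.
have [E' _ _ _] := H _ _ _ J_imag (U (- t) (Rmult_opp_opp t t)).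
have lin k : continuous (fun r => r * k) r.
  apply: (continuous_scal_l (K := R_AbsRing) (V := R_NormedModule)).
  exact: continuous_id.
split => //.
- have e : r * - t = - (r * t) by ring.
  by rewrite /ray e; move: E'; rewrite e Ea Eb.
- apply: (continuous_comp_2 _ _ _ _ (lin c) (lin t)).
  apply: (@C1_continuous _ al al_x al_y _ _ Uo) => u v.
  by case/(H _ _ _ J_imag) => _ [].
- apply: (continuous_comp_2 _ _ _ _ (lin c) (lin t)).
  apply: (@C1_continuous _ be be_x be_y _ _ Uo) => u v.
  by case/(H _ _ _ J_imag) => _ [].
Qed.

End IntrinsicFunctions.

(** * Auxiliary facts on improper integrals and linear maps *)

Lemma is_RInt_gen_ext_pos (V : NormedModule R_AbsRing) (h k : R -> V) (l : V) :
  (forall r, 0 < r -> h r = k r) ->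
  is_RInt_gen h (at_right 0) (Rbar_locally p_infty) l ->
  is_RInt_gen k (at_right 0) (Rbar_locally p_infty) l.
Proof.
move=> hk; apply: is_RInt_gen_ext.
apply: (Filter_prod _ _ _ _ _ at_right0_pos pinfty_pos) => a b a0 b0 r [ar _].
by apply: hk; apply: Rlt_trans ar; apply: Rmin_pos.
Qed.

Section LinearMaps.
Context {K : AbsRing} {U V W : NormedModule K}.

Lemma is_linear_scal_fun (L : U -> V) (k : K) :
  (forall x y : K, mult x y = mult y x) ->
  is_linear L -> is_linear (fun v => scal k (L v)).
Proof. by move=> C HL; apply: is_linear_comp HL _; apply: is_linear_scal_r. Qed.

Lemma is_linear_plus_fun (L M : U -> V) :
  is_linear L -> is_linear M -> is_linear (fun v => plus (L v) (M v)).
Proof.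
move=> HL HM; exact: (is_linear_comp _ _ (is_linear_prod _ _ HL HM) is_linear_plus).
Qed.

Lemma is_linear_opp_fun (L : U -> V) :
  is_linear L -> is_linear (fun v => opp (L v)).
Proof. by move=> HL; apply: is_linear_comp HL is_linear_opp. Qed.

Lemma is_linear_minus_fun (L M : U -> V) :
  is_linear L -> is_linear M -> is_linear (fun v => minus (L v) (M v)).
Proof. by move=> HL HM; apply: is_linear_plus_fun HL (is_linear_opp_fun HM). Qed.

End LinearMaps.

(** * The integrand of the functional calculus along one ray *)

Section Integrand.
Context {n : nat} {V : rightHilbertModule n}.
Variables (T : operator V) (omega theta : R).
Hypothesis T_bis : bisectorial omega T.
Hypothesis theta_pi2 : omega < theta < PI / 2.
Implicit Types (u v w : V) (J : cliff R n) (x y c t r : R)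
  (f : cliff R n -> cliff R n).

Let omega_pi2 : 0 < omega < PI / 2. Proof. by case: T_bis. Qed.
Let theta_pos : 0 < theta < PI / 2. Proof. lra. Qed.
Let cos_theta : 0 < cos theta. Proof. by apply: cos_gt_0; lra. Qed.

(** The ray runs inside the double sector of angle [theta], where [f] is controlled, and outside the
    closed one of angle [omega], which contains the spectrum. *)
Definition inner_direction c t :=
  c * c + t * t = 1 /\ cos theta < Rabs c < cos omega.

(** The last factor is the direction [c + J t] times [- J], coming from [ds_J]. *)
Definition integrand f J c t v r : V :=
  act (act (res T (ray J c t r) v) (f (ray J c t r))) (cplane J t (- c)).

Lemma ray_integralE f J c t v l : imag_sphere J ->
  ray_integral T f J (cplane J c t) v l =
  is_RInt_gen (integrand f J c t v) (at_right 0) (Rbar_locally p_infty) l.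
Proof.
move=> J_imag; rewrite /ray_integral; congr is_RInt_gen.
apply: functional_extensionality => r; rewrite cplaneZ.
rewrite [X in GRing.opp X](cplane_imag J) cplaneN cplaneM //; congr act.
by congr cplane; ring.
Qed.

Section Ray.
Variables (f : cliff R n -> cliff R n) (J : cliff R n) (c t : R).
Hypothesis J_imag : imag_sphere J.
Hypothesis ct : inner_direction c t.
Hypothesis f_N0 : Defs.N0 (double_sector theta) f.

Let dir : direction omega c t. Proof. by case: ct => e [? ?]; split; lra. Qed.
Let dirN : direction omega c (- t).
Proof. by case: ct => e [? ?]; split; lra. Qed.

(** With [f = a + J b] on the ray, the scalar acting on the resolvent is [p + J q] at [s] and
    [- p + J q] at [conj s]; this symmetry is what makes conjugate integrands combine with real
    coefficients. *)
Lemma ray_values : exists a b : R -> R, forall r, 0 < r ->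
  [/\ forall v, integrand f J c t v r = act (res T (ray J c t r) v)
        (cplane J (a r * t + b r * c) (b r * t - a r * c)),
      forall v, integrand f J c (- t) v r = act (res T (ray J c (- t) r) v)
        (cplane J (- (a r * t + b r * c)) (b r * t - a r * c)),
      cnorm (f (ray J c t r)) = sqrt (a r * a r + b r * b r),
      continuous a r & continuous b r].
Proof.
case: ct => ct1 [ct2 _]; case: f_N0 => f_int _.
have [a [b H]] := intrinsic_ray J_imag theta_pos f_int ct1 ct2.
exists a, b => r /H [E1 E2 Ca Cb]; split => //.
- move=> v; rewrite /integrand E1 -actM cplaneM //; congr (act _ (cplane _ _ _)); ring.
- move=> v; rewrite /integrand E2 -actM cplaneM //; congr (act _ (cplane _ _ _)); ring.
- by rewrite E1 cnorm_cplane.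
Qed.

Lemma integrand_linear r : 0 < r -> is_linear (fun v => integrand f J c t v r).
Proof.
move=> r0; have [a [b /(_ r r0) [E _ _ _ _]]] := ray_values.
rewrite (functional_extensionality _ _ E).
apply: (is_linear_comp (res T (ray J c t r)) (fun v => act v (cplane J _ _))).
  exact: (res_linear T_bis J_imag dir).
exact: act_cplane_linear.
Qed.

Lemma integrand_commutes r : 0 < r -> commutes T (fun v => integrand f J c t v r).
Proof.
move=> r0 v w Tvw; have T_lin : right_linear T by case: T_bis => _ [].
do 2!apply: right_linear_act => //.
exact: (res_commutes T_bis J_imag dir).
Qed.

Lemma integrand_continuous v r : 0 < r -> continuous (integrand f J c t v) r.
Proof.
move=> r0; have [a [b H]] := ray_values.
have [_ _ _ Ca Cb] := H r r0.
have Cr : continuous (fun r => res T (ray J c t r) v) r.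
  exact: (res_continuous T_bis J_imag dir).
have Clin k : continuous (fun r => a r * k) r /\ continuous (fun r => b r * k) r.
  by split; apply: (continuous_scal_l (K := R_AbsRing) (V := R_NormedModule)).
apply: (continuous_ext_loc _ (fun r => plus
    (scal (a r * t + b r * c) (res T (ray J c t r) v))
    (scal (b r * t - a r * c) (act (res T (ray J c t r) v) J)))).
  exists (mkposreal r r0) => r'.
  rewrite /ball /= /AbsRing_ball /abs /minus /plus /opp /= => rr'.
  have r'0 : 0 < r' by split_Rabs; lra.
  by have [-> _ _ _ _] := H r' r'0; rewrite act_cplane.
apply: continuous_plus; apply: continuous_scal => //.
- by apply: (continuous_plus (V := R_NormedModule)); apply Clin.
- by apply: (continuous_minus (V := R_NormedModule)); apply Clin.
apply: (continuous_comp _ (fun w : V => act w J) _ Cr); apply: linear_cont.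
by rewrite (cplane_imag J); apply: act_cplane_linear.
Qed.

Lemma integrand_integral : exists2 K, 0 <= K & forall v, exists2 l,
  is_RInt_gen (integrand f J c t v) (at_right 0) (Rbar_locally p_infty) l
  & norm l <= K * norm v.
Proof.
have [a [b H]] := ray_values; case: f_N0 => _ [al [Cf [al0 Cf0 Hf]]].
have [C C0 HC] := res_bound T_bis J_imag dir.
have K0 : 0 <= C * Cf * (2 / al).
  by apply: Rmult_le_pos; [nra|apply: Rlt_le; apply: Rdiv_lt_0_compat; lra].
exists (C * Cf * (2 / al)) => // v.
have Kv : 0 <= C * Cf * norm v.
  by apply: Rmult_le_pos (norm_ge_0 _); apply: Rmult_le_pos.
have h_le r : 0 < r -> norm (integrand f J c t v r) <=
    C * Cf * norm v * (Rpower r al / (1 + Rpower r (2 * al)) / r).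
  move=> r0; have [-> _ E _ _] := H r r0; rewrite norm_act //.
  (* The factor [t - J c] has modulus 1, so only the modulus of [f] remains. *)
  set N := sqrt _; have -> : N = cnorm (f (ray J c t r)).
    rewrite E; congr sqrt; rewrite -[RHS]Rmult_1_r -(proj1 ct); ring.
  have Uf : double_sector theta (ray J c t r).
    apply/double_sector_cplane => //; have := cnorm_ray J_imag dir r0.
    rewrite cnorm_cplane // => ->.
    rewrite Rabs_mult (Rabs_pos_eq r); last lra.
    by rewrite Rmult_comm; apply: Rmult_lt_compat_l => //; case: ct => _ [].
  have := Hf _ Uf; rewrite (cnorm_ray J_imag dir r0) => fle.
  have := HC r v r0 => rle.
  apply: Rle_trans (Rmult_le_compat _ _ _ _ (cnorm_ge0 _) (norm_ge_0 _) fle rle) _.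
  by apply: Req_le; rewrite /Rdiv; ring.
have [l Hl le_l] := is_RInt_gen_power al0 Kv (@integrand_continuous v) h_le.
by exists l => //; apply: Rle_trans le_l _; apply: Req_le; ring.
Qed.

(* For s = ray J c t r and u = Q_s^-1 v, the difference of the integrands at
   conj s and s is a combination of u and T u with real coefficients that
   depend neither on v nor on J. *)
Lemma integrand_pair_commute (L : V -> V) v r : 0 < r -> is_linear L ->
  commutes T L ->
  minus (integrand f J c (- t) (L v) r) (integrand f J c t (L v) r) =
  L (minus (integrand f J c (- t) v r) (integrand f J c t v r)).
Proof.
move=> r0 L_lin LT; have [a [b /(_ r r0) [E1 E2 _ _ _]]] := ray_values.
rewrite !E1 !E2 {E1 E2}; set p := _ + _; set q := _ - _.
have T_lin : right_linear T by case: T_bis => _ [].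
have [u Qu] := Q_ex T_bis J_imag dir v r0.
(* [Q] depends on [t] only through its square, so the same [u] serves both conjugate points. *)
have QN u' v' : Q (ray J c t r) T u' v' -> Q (ray J c (- t) r) T u' v'.
  rewrite /ray !Q_cplane //.
  by have -> : r * - t * (r * - t) = r * t * (r * t) by ring.
have [u1 [u2 [Tu Tu1 Ev]]] : exists u1 u2, [/\ T u u1, T u1 u2 &
    v = plus (minus u2 (scal (2 * (r * c)) u1))
             (scal (r * c * (r * c) + r * t * (r * t)) u)].
  by move/Q_cplane: Qu; apply.
have QL : Q (ray J c t r) T (L u) (L v).
  apply/Q_cplane => //; exists (L u1), (L u2); split; [exact: LT|exact: LT|].
  rewrite Ev (linear_plus _ L_lin) /minus (linear_plus _ L_lin).
  by rewrite (linear_opp _ _ L_lin) !(linear_scal _ L_lin).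
have form u' v' w' : Q (ray J c t r) T u' v' -> T u' w' ->
    minus (act (res T (ray J c (- t) r) v') (cplane J (- p) q))
          (act (res T (ray J c t r) v') (cplane J p q)) =
    plus (scal (-2 * (r * c * p + r * t * q)) u') (scal (2 * p) w').
  move=> Qu' Tu'.
  rewrite (res_eq T_bis J_imag dir r0 (Q_resolvent T_lin J_imag Qu' Tu')).
  rewrite (res_eq T_bis J_imag dirN r0 (Q_resolvent T_lin J_imag (QN _ _ Qu') Tu')).
  rewrite !act_cplane !act_minusl !actDl !act_scall act_imag2 //.
  by vector.
rewrite (form _ _ _ Qu Tu) (form _ _ _ QL (LT _ _ Tu)).
by rewrite (linear_plus _ L_lin) !(linear_scal _ L_lin).
Qed.

End Ray.
End Integrand.

(** * The calculus on [N0]: boundedness, linearity and commutation *)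

Section Calculus.
Context {n : nat} {V : rightHilbertModule n}.
Variables (T : operator V) (omega theta : R).
Hypothesis T_bis : bisectorial omega T.
Hypothesis theta_pi2 : omega < theta < PI / 2.
Implicit Types (u v w : V) (J : cliff R n) (x y c t r phi : R)
  (f g : cliff R n -> cliff R n).

Let omega_pi2 : 0 < omega < PI / 2. Proof. by case: T_bis. Qed.

Definition conj_pair f J c t v r : V :=
  minus (integrand T f J c (- t) v r) (integrand T f J c t v r).

(** The four rays of the contour are gathered into one integrand, conjugate rays being paired with
    the signs of their orientation so that [integrand_pair_commute] applies. *)
Definition kernel f J phi v r : V := scal (/ (2 * PI))
  (plus (conj_pair f J (cos phi) (sin phi) v r)
        (conj_pair f J (- cos phi) (- sin phi) v r)).

(** A total function standing for the relation [calc_N0_at]; for [f] in [N0] the two agree by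
    [calc_P] and [calc_eq]. *)
Definition calc f J phi v : V :=
  RInt_gen (kernel f J phi v) (at_right 0) (Rbar_locally p_infty).

Definition admissible J phi := imag_sphere J /\ omega < phi < theta.

Lemma admissible_direction J phi : admissible J phi ->
  [/\ inner_direction omega theta (cos phi) (sin phi),
      inner_direction omega theta (cos phi) (- sin phi),
      inner_direction omega theta (- cos phi) (sin phi) &
      inner_direction omega theta (- cos phi) (- sin phi)].
Proof.
case=> _ phi1.
have cs : cos phi * cos phi + sin phi * sin phi = 1.
  by have := sin2_cos2 phi; rewrite /Rsqr; lra.
have c1 : cos theta < cos phi < cos omega.
  by split; apply: cos_decreasing_1; lra.
have c0 : 0 < cos phi by apply: cos_gt_0; lra.
by split; split; rewrite ?Rabs_Ropp ?(Rabs_pos_eq (cos phi)); lra.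
Qed.

Section Index.
Variables (f : cliff R n -> cliff R n) (J : cliff R n) (phi : R).
Hypothesis Jphi : admissible J phi.

Lemma calc_N0_at_kernel v w : calc_N0_at T f J phi v w ->
  is_RInt_gen (kernel f J phi v) (at_right 0) (Rbar_locally p_infty) w.
Proof.
case: Jphi => J_imag _ [l1 [l2 [l3 [l4 [[]]]]]].
rewrite /cexp cplaneN cos_neg sin_neg.
move=> H1 H2 []; rewrite cplaneN ?Ropp_involutive => H3 H4 ->.
move: H1 H2 H3 H4; rewrite !ray_integralE // => H1 H2 H3 H4.
apply: is_RInt_gen_scal; apply: is_RInt_gen_plus; apply: is_RInt_gen_minus => //.
by rewrite Ropp_involutive.
Qed.

Lemma calc_unique v w :
  is_RInt_gen (kernel f J phi v) (at_right 0) (Rbar_locally p_infty) w ->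
  calc f J phi v = w.
Proof. by move=> H; rewrite -(is_RInt_gen_unique _ _ H). Qed.

Lemma calc_eq v w : calc_N0_at T f J phi v w -> w = calc f J phi v.
Proof. by move/calc_N0_at_kernel/calc_unique. Qed.

Hypothesis f_N0 : Defs.N0 (double_sector theta) f.

Lemma calc_N0_at_ex : exists2 K, 0 <= K & forall v, exists2 w,
  calc_N0_at T f J phi v w & norm w <= K * norm v.
Proof.
have [D1 D2 D3 D4] := admissible_direction Jphi; have J_imag := proj1 Jphi.
have [K1 K1_0 H1] := integrand_integral T_bis theta_pi2 J_imag D1 f_N0.
have [K2 K2_0 H2] := integrand_integral T_bis theta_pi2 J_imag D2 f_N0.
have [K3 K3_0 H3] := integrand_integral T_bis theta_pi2 J_imag D4 f_N0.
have [K4 K4_0 H4] := integrand_integral T_bis theta_pi2 J_imag D3 f_N0.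
have pi0 : 0 < / (2 * PI) by apply: Rinv_0_lt_compat; have := PI_RGT_0; lra.
exists (/ (2 * PI) * (K1 + K2 + K3 + K4)); first by apply: Rmult_le_pos; lra.
move=> v; have [l1 I1 le1] := H1 v; have [l2 I2 le2] := H2 v.
have [l3 I3 le3] := H3 v; have [l4 I4 le4] := H4 v.
exists (scal (/ (2 * PI)) (plus (minus l2 l1) (minus l4 l3))).
  exists l1, l2, l3, l4; rewrite /cexp cos_neg sin_neg !cplaneN Ropp_involutive.
  by rewrite !ray_integralE.
apply: Rle_trans (norm_scal _ _) _.
rewrite /abs /= Rabs_pos_eq; last lra.
rewrite Rmult_assoc; apply: Rmult_le_compat_l; first lra.
apply: Rle_trans (norm_triangle _ _) _.
apply: Rle_trans (Rplus_le_compat _ _ _ _ (norm_triangle _ _) (norm_triangle _ _)) _.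
by rewrite !norm_opp; lra.
Qed.

Lemma calc_P v : calc_N0_at T f J phi v (calc f J phi v).
Proof.
by have [K _ /(_ v) [w Hw _]] := calc_N0_at_ex; rewrite -(calc_eq Hw).
Qed.

Lemma calc_int v : is_RInt_gen (kernel f J phi v)
  (at_right 0) (Rbar_locally p_infty) (calc f J phi v).
Proof. exact: calc_N0_at_kernel (calc_P v). Qed.

Lemma kernel_linear r : 0 < r -> is_linear (fun v => kernel f J phi v r).
Proof.
move=> r0; have [D1 D2 D3 D4] := admissible_direction Jphi.
have J_imag := proj1 Jphi.
have lin := integrand_linear T_bis theta_pi2 J_imag _ f_N0 r0.
apply: is_linear_scal_fun; first by move=> x y; apply: Rmult_comm.
apply: is_linear_plus_fun; apply: is_linear_minus_fun; apply: lin => //.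
by rewrite Ropp_involutive.
Qed.

Lemma kernel_commutes r : 0 < r -> commutes T (fun v => kernel f J phi v r).
Proof.
move=> r0 v w Tvw; have [D1 D2 D3 D4] := admissible_direction Jphi.
have J_imag := proj1 Jphi.
have com c t := fun D =>
  @integrand_commutes _ _ _ _ _ T_bis theta_pi2 f J c t J_imag D r r0 _ _ Tvw.
have T_lin : right_linear T by case: T_bis => _ [].
change (T (kernel f J phi v r) (kernel f J phi w r)).
apply: right_linear_scal => //; apply: right_linear_plus => //;
  apply: right_linear_minus => //; apply: com => //.
by rewrite Ropp_involutive.
Qed.

Lemma calc_linear : is_linear (calc f J phi).
Proof.
split=> [v w|k v|].
- apply: calc_unique.
  apply: (is_RInt_gen_ext_pos _
    (is_RInt_gen_plus _ _ _ _ (@calc_int v) (@calc_int w))) => r r0.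
  by rewrite (linear_plus _ (kernel_linear r0)).
- apply: calc_unique.
  apply: (is_RInt_gen_ext_pos _
    (is_RInt_gen_scal _ k _ (@calc_int v))) => r r0.
  by rewrite (linear_scal _ (kernel_linear r0)).
have [K K0 HK] := calc_N0_at_ex; exists (K + 1); split; first lra.
move=> v; have [w Hw le_w] := HK v; rewrite -(calc_eq Hw).
by have := norm_ge_0 v; lra.
Qed.

Lemma calc_commute_linear (L : V -> V) v : is_linear L ->
  (forall r w, 0 < r -> L (kernel f J phi w r) = kernel f J phi (L w) r) ->
  calc f J phi (L v) = L (calc f J phi v).
Proof.
move=> L_lin LK; apply: calc_unique.
apply: (is_RInt_gen_ext_pos _ (is_RInt_gen_linear L_lin (@calc_int v))) => r r0.
exact: LK.
Qed.

(** [L] is only real linear and may fail to commute with the action of [J], hence with a single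
    integrand; on conjugate pairs [J] has disappeared. *)
Lemma kernel_commute_linear (L : V -> V) r w : 0 < r -> is_linear L ->
  commutes T L -> L (kernel f J phi w r) = kernel f J phi (L w) r.
Proof.
move=> r0 L_lin LT; have [D1 D2 D3 D4] := admissible_direction Jphi.
have J_imag := proj1 Jphi.
have com c t := fun D =>
  @integrand_pair_commute _ _ _ _ _ T_bis theta_pi2 f J c t J_imag D f_N0
    L w r r0 L_lin LT.
rewrite /kernel (linear_scal _ L_lin) (linear_plus _ L_lin) /conj_pair.
by rewrite !com.
Qed.

End Index.

(* No Fubini theorem is needed: the kernels of f at each r are bounded and
   commute with T, hence with g(T), so g(T) can be pulled through the integral
   that defines f(T). *)
Lemma calc_commute f g J J' phi phi' v :
  admissible J phi -> admissible J' phi' ->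
  Defs.N0 (double_sector theta) f -> Defs.N0 (double_sector theta) g ->
  calc f J phi (calc g J' phi' v) = calc g J' phi' (calc f J phi v).
Proof.
move=> A A' f_N0 g_N0; apply: calc_commute_linear => //; first exact: calc_linear.
move=> r w r0.
apply: (@calc_commute_linear g J' phi' A' g_N0 (fun w => kernel f J phi w r)).
  exact: kernel_linear.
move=> r' w' r'0.
apply: (@kernel_commute_linear g J' phi' A' g_N0 (fun w => kernel f J phi w r)) => //.
  exact: kernel_linear.
exact: kernel_commutes.
Qed.

Lemma kernel_comb f f1 f2 (k : R) J phi v r : admissible J phi -> 0 < r ->
  (forall s, double_sector theta s -> f s = GRing.add (f1 s) (GRing.scale k (f2 s))) ->
  kernel f J phi v r =
  plus (kernel f1 J phi v r) (scal k (kernel f2 J phi v r)).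
Proof.
move=> A r0 E; have [D1 D2 D3 D4] := admissible_direction A.
have J_imag := proj1 A.
have I c t : inner_direction omega theta c t -> integrand T f J c t v r =
    plus (integrand T f1 J c t v r) (scal k (integrand T f2 J c t v r)).
  case=> ct1 [ct2 _]; rewrite /integrand E; last first.
    apply/double_sector_cplane => //; first lra.
    have -> : r * c * (r * c) + r * t * (r * t) = r * r * (c * c + t * t) by ring.
    rewrite ct1 Rmult_1_r sqrt_square ?Rabs_mult ?(Rabs_pos_eq r); nra.
  by rewrite actDr act_scalr actDl act_scall.
rewrite /kernel /conj_pair !I ?Ropp_involutive //; vector.
Qed.

(** The identity is asked only on the double sector, where the rays run. With [k = 0] it exchanges
    [f] for a function equal to it there. *)
Lemma calc_comb f f1 f2 (k : R) J phi v : admissible J phi ->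
  Defs.N0 (double_sector theta) f1 -> Defs.N0 (double_sector theta) f2 ->
  (forall s, double_sector theta s -> f s = GRing.add (f1 s) (GRing.scale k (f2 s))) ->
  calc f J phi v = plus (calc f1 J phi v) (scal k (calc f2 J phi v)).
Proof.
move=> A f1_N0 f2_N0 E; apply: calc_unique.
apply: (is_RInt_gen_ext_pos _ (is_RInt_gen_plus _ _ _ _ (@calc_int f1 J phi A f1_N0 v)
  (is_RInt_gen_scal _ k _ (@calc_int f2 J phi A f2_N0 v)))) => r r0.
by rewrite (kernel_comb v A r0 E).
Qed.

End Calculus.

(** * Splitting a function of class [N0] by the two indicators *)

Section FunctionClasses.
Context {n : nat}.
Variable theta : R.
Hypothesis theta_pi2 : 0 < theta < PI / 2.
Implicit Types (s J : cliff R n) (e f : cliff R n -> cliff R n) (k : R).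

Let U := @double_sector n theta.

Lemma double_sector_Sc s : U s -> Sc s <> 0.
Proof.
move=> Us; have [ps s0] : paravector s /\ s <> 0%R.
  case: Us => -[pt t0 _]; split=> //.
    by rewrite -[s]GRing.opprK; apply: paravectorN.
  by move=> s0; apply: t0; rewrite s0 GRing.oppr0.
move: Us; rewrite /U double_sectorE // => H S0; move: H; rewrite S0 Rabs_R0.
have := cnorm_gt0 s0; have : 0 < cos theta by apply: cos_gt_0; lra.
by nra.
Qed.

Lemma ind_posE s : U s ->
  ind_pos s = 1%R /\ ind_neg s = 0%R /\ 0 < Sc s \/
  ind_pos s = 0%R /\ ind_neg s = 1%R /\ Sc s < 0.
Proof.
move/double_sector_Sc; rewrite /ind_pos /ind_neg.
by case: Rlt_dec => [p|p]; case: Rlt_dec => [q|q] S0; (lra || by [left|right]).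
Qed.

Lemma C1_at_comb (a1 a1x a1y a2 a2x a2y : R -> R -> R) k x y :
  C1_at a1 a1x a1y x y -> C1_at a2 a2x a2y x y ->
  C1_at (fun x y => a1 x y + k * a2 x y) (fun x y => a1x x y + k * a2x x y)
        (fun x y => a1y x y + k * a2y x y) x y.
Proof.
move=> [D1 D2 D3 D4] [E1 E2 E3 E4]; split.
- by apply: (is_derive_plus (V := R_NormedModule)); [|apply: is_derive_scal].
- by apply: (is_derive_plus (V := R_NormedModule)); [|apply: is_derive_scal].
- apply: continuity_2d_pt_plus => //; apply: continuity_2d_pt_mult => //.
  exact: continuity_2d_pt_const.
- apply: continuity_2d_pt_plus => //; apply: continuity_2d_pt_mult => //.
  exact: continuity_2d_pt_const.
Qed.

Lemma intrinsic_comb f f1 f2 k : intrinsic U f1 -> intrinsic U f2 ->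
  (forall s, U s -> f s = GRing.add (f1 s) (GRing.scale k (f2 s))) ->
  intrinsic U f.
Proof.
move=> [a1 [b1 [a1x [a1y [b1x [b1y H1]]]]]] [a2 [b2 [a2x [a2y [b2x [b2y H2]]]]]] E.
pose comb (g1 g2 : R -> R -> R) x y := g1 x y + k * g2 x y.
exists (comb a1 a2), (comb b1 b2), (comb a1x a2x), (comb a1y a2y),
  (comb b1x b2x), (comb b1y b2y) => x y J J_imag Us.
have [F1 [A1 B1] [CR1 CR1'] [S1 S1']] := H1 _ _ _ J_imag Us.
have [F2 [A2 B2] [CR2 CR2'] [S2 S2']] := H2 _ _ _ J_imag Us.
split.
- by rewrite E // F1 F2 cplaneZ cplaneD.
- by split; apply: C1_at_comb.
- by rewrite /comb CR1 CR2 CR1' CR2'; split; ring.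
- by rewrite /comb S1 S2 S1' S2'; split; ring.
Qed.

Lemma N0_dominated e f : Defs.N0 U e -> intrinsic U f ->
  (forall s, U s -> cnorm (f s) <= cnorm (e s)) -> Defs.N0 U f.
Proof.
move=> [_ [a [C [a0 C0 H]]]] f_int le_fe; split=> //; exists a, C; split=> // s Us.
exact: Rle_trans (le_fe s Us) (H s Us).
Qed.

Lemma cnormZ k s : cnorm (GRing.scale k s) = Rabs k * cnorm s.
Proof.
rewrite -sqrt_Rsqr_abs -sqrt_mult; [|exact: Rle_0_sqr|exact: sum_sqr_ge0].
rewrite /cnorm; congr sqrt; rewrite RmultE GRing.mulr_sumr.
by apply: eq_bigr => A _; rewrite ffunE GRing.exprMn.
Qed.

Lemma cnorm0 : cnorm (0%R : cliff R n) = 0.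
Proof. by rewrite /cnorm big1 ?sqrt_0 // => A _; rewrite ffunE GRing.expr0n. Qed.

(** On the double sector [e ind_neg] is [e - e ind_pos], hence intrinsic as a real combination. At
    each point exactly one indicator is 1, so both functions are dominated by [e] when
    [Rabs k <= 1]. *)
Lemma N0_split e k :
  Defs.N0 U e -> Defs.N0 U (fun s => GRing.mul (e s) (ind_pos s)) ->
  -1 <= k <= 1 ->
  Defs.N0 U (fun s => GRing.mul (e s) (ind_neg s)) /\
  Defs.N0 U (fun s => GRing.add (GRing.mul (e s) (ind_pos s))
                       (GRing.scale k (GRing.mul (e s) (ind_neg s)))).
Proof.
move=> eN epN k1; pose ep s := GRing.mul (e s) (ind_pos s).
pose em s := GRing.mul (e s) (ind_neg s).
have em_int : intrinsic U em.
  apply: (intrinsic_comb (k := -1) (proj1 eN) (proj1 epN)) => s Us.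
  have -> : -1 = GRing.opp (GRing.one R) by [].
  rewrite GRing.scaleN1r /em.
  case: (ind_posE Us) => [] [-> [-> _]];
    by rewrite !GRing.mulr1 ?GRing.mulr0 ?GRing.subrr ?GRing.subr0.
split; apply: (N0_dominated eN) => //.
- move=> s Us; rewrite /em; case: (ind_posE Us) => [] [_ [-> _]].
    by rewrite GRing.mulr0 cnorm0; apply: cnorm_ge0.
  by rewrite GRing.mulr1; apply: Rle_refl.
- exact: (intrinsic_comb (proj1 epN) em_int (k := k)).
move=> s Us; case: (ind_posE Us) => [] [-> [-> _]].
  by rewrite GRing.mulr1 GRing.mulr0 GRing.scaler0 GRing.addr0; apply: Rle_refl.
rewrite GRing.mulr1 GRing.mulr0 GRing.add0r cnormZ.
by have := cnorm_ge0 (e s); split_Rabs; nra.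
Qed.

End FunctionClasses.

(** * The indicators belong to [Ninfty] *)

Section IndicatorFunctions.
Context {n : nat}.
Variable theta : R.
Hypothesis theta_pi2 : 0 < theta < PI / 2.

Lemma C1_at_locally_const (g : R -> R -> R) (k x y : R) :
  locally x (fun x' => forall y', g x' y' = k) ->
  C1_at g (fun _ _ => 0) (fun _ _ => 0) x y.
Proof.
move=> H; split; try exact: continuity_2d_pt_const.
  apply: (is_derive_ext_loc (fun _ => k)); last exact: is_derive_const.
  by apply: filter_imp H => x' ->.
apply: (is_derive_ext (fun _ => k)); last exact: is_derive_const.
by move=> y'; rewrite (locally_singleton _ _ H).
Qed.

(** Here [alpha] is [g] of the real coordinate and [beta = 0]; the double sector misses [Sc s = 0],
    so [alpha] is locally constant and all partial derivatives vanish. *)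
Lemma Ninfty_sign (f : cliff R n -> cliff R n) (g : R -> R) :
  (forall s, f s = GRing.scale (g (Sc s)) 1%R) ->
  (forall x, x <> 0 -> locally x (fun x' => g x' = g x)) ->
  (forall x, 0 <= g x <= 1) ->
  Ninfty (double_sector theta) f.
Proof.
move=> E g_loc g01; split.
  exists (fun x _ => g x), (fun _ _ => 0), (fun _ _ => 0), (fun _ _ => 0),
    (fun _ _ => 0), (fun _ _ => 0) => x y J J_imag Us.
  have x0 : x <> 0.
    by have := double_sector_Sc theta_pi2 Us; rewrite Sc_cplane.
  split; last by rewrite Ropp_0.
  - by rewrite E Sc_cplane // (cplane_real J).
  - split; last by apply: (@C1_at_locally_const _ 0); apply: filter_forall.
    by apply: (@C1_at_locally_const _ (g x)); apply: filter_imp (g_loc x x0).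
  - by rewrite Ropp_0.
exists (cnorm (1%R : cliff R n)) => s _; rewrite E cnormZ.
have g1 := g01 (Sc s); rewrite -[X in _ <= X]Rmult_1_l.
by apply: Rmult_le_compat_r (cnorm_ge0 _) _; rewrite Rabs_pos_eq; lra.
Qed.

Lemma Ninfty_ind_pos : Ninfty (double_sector theta) (@ind_pos n).
Proof.
apply: (Ninfty_sign (g := fun x => if Rlt_dec 0 x then 1 else 0)).
- move=> s; rewrite /ind_pos.
  by case: Rlt_dec => ?; rewrite ?GRing.scale1r ?GRing.scale0r.
- move=> x x0; have e : 0 < Rabs x by apply: Rabs_pos_lt.
  exists (mkposreal _ e) => x'.
  rewrite /ball /= /AbsRing_ball /abs /minus /plus /opp /=.
  by case: Rlt_dec => H; case: Rlt_dec => H' // B; split_Rabs; lra.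
- by move=> x; case: Rlt_dec => ? /=; lra.
Qed.

Lemma Ninfty_ind_neg : Ninfty (double_sector theta) (@ind_neg n).
Proof.
apply: (Ninfty_sign (g := fun x => if Rlt_dec x 0 then 1 else 0)).
- move=> s; rewrite /ind_neg.
  by case: Rlt_dec => ?; rewrite ?GRing.scale1r ?GRing.scale0r.
- move=> x x0; have e : 0 < Rabs x by apply: Rabs_pos_lt.
  exists (mkposreal _ e) => x'.
  rewrite /ball /= /AbsRing_ball /abs /minus /plus /opp /=.
  by case: Rlt_dec => H; case: Rlt_dec => H' // B; split_Rabs; lra.
- by move=> x; case: Rlt_dec => ? /=; lra.
Qed.

End IndicatorFunctions.

(** * Bounded operators as functions, their ranges and kernels *)

Section BoundedOperators.
Context {n : nat} {V : rightHilbertModule n}.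
Implicit Types (A : operator V) (v w : V).

Definition op_fun A v : V := iota (A v).

Lemma op_funP A v : bounded_op A -> A v (op_fun A v).
Proof.
case=> -[A_fun _ _ _] A_tot _; apply: iota_correct; have [w Aw] := A_tot v.
by exists w; split => // w'; apply: A_fun.
Qed.

Lemma op_fun_eq A v w : bounded_op A -> A v w -> op_fun A v = w.
Proof.
move=> bA; have := @op_funP A v bA.
by case: bA => -[A_fun _ _ _] _ _; apply: A_fun.
Qed.

Lemma op_fun_linear A : bounded_op A -> is_linear (op_fun A).
Proof.
move=> bA; case: (bA) => -[_ _ A_plus A_act] _ [C HC]; split=> [v w|k v|].
- by apply: op_fun_eq => //; apply: A_plus; apply: op_funP.
- by apply: op_fun_eq => //; rewrite -!act_scal; apply: A_act; apply: op_funP.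
exists (Rabs C + 1); split; first by have := Rabs_pos C; lra.
move=> v; apply: Rle_trans (HC _ _ (op_funP v bA)) _.
apply: Rmult_le_compat_r (norm_ge_0 _) _; split_Rabs; lra.
Qed.

Lemma ran_op_fun A w : bounded_op A -> ran A w <-> exists v, w = op_fun A v.
Proof.
move=> bA; split=> -[v].
  by move=> Avw; exists v; rewrite (op_fun_eq bA Avw).
by move->; exists v; apply: op_funP.
Qed.

Lemma ran_right_submodule A : bounded_op A -> right_submodule (ran A).
Proof.
case=> -[_ A0 A_plus A_act] _ _; split; first by exists zero.
- by move=> v w [v' Av] [w' Aw]; exists (plus v' w'); apply: A_plus.
- by move=> v s [v' Av]; exists (act v' s); apply: A_act.
Qed.

Lemma closed_kernel (L : V -> V) : is_linear L -> closed (fun v => L v = zero).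
Proof.
move=> L_lin v H; apply: NNPP => Lv; apply: H.
have N : 0 < norm (L v).
  by have [//|/esym/norm_eq_zero] := norm_ge_0 (L v).
apply: (linear_cont L v L_lin (fun y => y <> zero)); apply: locally_le_locally_norm.
exists (mkposreal _ N) => y yv y0; move: yv; rewrite y0 /ball_norm /=.
by rewrite /minus plus_zero_l norm_opp; lra.
Qed.

End BoundedOperators.

(** * Algebraic relations between the two projectors *)

Section Projectors.
Context {n : nat} {V : rightHilbertModule n}.
Variables (T : operator V) (omega theta : R).
Hypothesis T_bis : bisectorial omega T.
Hypothesis theta_pi2 : omega < theta < PI / 2.
Implicit Types (u v w x : V) (J : cliff R n) (phi : R)
  (e f g : cliff R n -> cliff R n).

Let U := @double_sector n theta.
Let theta_pos : 0 < theta < PI / 2.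
Proof. by case: T_bis => ?; lra. Qed.

Notation C f J phi := (calc T f J phi).
Notation adm := (admissible omega theta).

Lemma calc_N0P f J phi v : adm J phi -> Defs.N0 U f ->
  calc_N0 omega theta T f v (C f J phi v).
Proof.
move=> A fN; exists phi, J; case: (A) => ? ?; split=> //.
exact: (calc_P T_bis theta_pi2).
Qed.

(** Since [e(T)] and [(e g)(T)] commute, [e(T)] sends [(e g)(T) x] to [(e g)(T) e(T) x], which is
    the equation defining [g(T)] at [e(T) x]. *)
Lemma calc_Ninfty_regularized e g J J' phi phi' x :
  adm J phi -> adm J' phi' -> regularizer omega theta T g e ->
  calc_Ninfty omega theta T g (C e J phi x)
    (C (fun s => GRing.mul (e s) (g s)) J' phi' x).
Proof.
move=> A A' re; case: (re) => eN egN _; exists e => //.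
exists (C e J phi (C (fun s => GRing.mul (e s) (g s)) J' phi' x)).
  by rewrite (calc_commute T_bis theta_pi2 _ A A' eN egN); apply: calc_N0P.
exact: calc_N0P.
Qed.

(** [f(T)] commutes with [e(T)] and [(e g)(T)], so it carries the intermediate vector [u] to one
    that witnesses the new value. *)
Lemma calc_Ninfty_commute g f J phi v w : adm J phi -> Defs.N0 U f ->
  calc_Ninfty omega theta T g v w ->
  calc_Ninfty omega theta T g (C f J phi v) (C f J phi w).
Proof.
move=> A fN [e re [u [phi1 [J1 [p1 I1 H1]]] [phi2 [J2 [p2 I2 H2]]]]].
case: (re) => eN egN _.
have A1 : adm J1 phi1 by []. have A2 : adm J2 phi2 by [].
exists e => //; exists (C f J phi u).
  rewrite (calc_eq A1 H1) (calc_commute T_bis theta_pi2 _ A A1 fN egN).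
  exact: calc_N0P.
rewrite (calc_eq A2 H2) (calc_commute T_bis theta_pi2 _ A A2 fN eN).
exact: calc_N0P.
Qed.

Variables (J : cliff R n) (phi : R).
Hypothesis Jphi : adm J phi.

Let P := op_fun (P_pos omega theta T).
Let M := op_fun (P_neg omega theta T).
Hypothesis P_bnd : bounded_op (P_pos omega theta T).
Hypothesis M_bnd : bounded_op (P_neg omega theta T).

Variable e : cliff R n -> cliff R n.
Hypothesis e_reg : regularizer omega theta T (@ind_pos n) e.

Let ep s := GRing.mul (e s) (ind_pos s).
Let em s := GRing.mul (e s) (ind_neg s).

Let eN : Defs.N0 U e. Proof. by case: e_reg. Qed.
Let epN : Defs.N0 U ep. Proof. by case: e_reg. Qed.
Let emN : Defs.N0 U em.
Proof. by have [] := N0_split theta_pos (k := 0) eN epN; [lra|]. Qed.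
Let e_inj : op_injective (calc_N0 omega theta T e). Proof. by case: e_reg. Qed.

Let e_reg_neg : regularizer omega theta T (@ind_neg n) e.
Proof. by split. Qed.

(** The contour [J'], [phi'] occurs on the right only: single-valuedness of [P_pos] makes [ep(T)]
    independent of the contour. *)
Let P_e J' phi' x : adm J' phi' -> P (C e J phi x) = C ep J' phi' x.
Proof. by move=> A; apply: op_fun_eq => //; apply: calc_Ninfty_regularized. Qed.

Let M_e J' phi' x : adm J' phi' -> M (C e J phi x) = C em J' phi' x.
Proof. by move=> A; apply: op_fun_eq => //; apply: calc_Ninfty_regularized. Qed.

Let P_C f v : Defs.N0 U f -> P (C f J phi v) = C f J phi (P v).
Proof.
by move=> fN; apply: op_fun_eq => //; apply: calc_Ninfty_commute => //; apply: op_funP.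
Qed.

Let M_C f v : Defs.N0 U f -> M (C f J phi v) = C f J phi (M v).
Proof.
by move=> fN; apply: op_fun_eq => //; apply: calc_Ninfty_commute => //; apply: op_funP.
Qed.

Let C_inj v w : C e J phi v = C e J phi w -> v = w.
Proof.
by move=> E; apply: (e_inj (w := C e J phi v)); [|rewrite E]; apply: calc_N0P.
Qed.

Let P_lin : is_linear P. Proof. exact: op_fun_linear. Qed.
Let M_lin : is_linear M. Proof. exact: op_fun_linear. Qed.
Let C_lin : is_linear (C e J phi).
Proof. exact: (calc_linear T_bis theta_pi2). Qed.

Lemma projectors_sum v : plus (P v) (M v) = v.
Proof.
apply: C_inj; rewrite (linear_plus _ C_lin) -P_C // -M_C //.
rewrite (P_e _ Jphi) (M_e _ Jphi).
rewrite (@calc_comb _ _ _ _ _ T_bis theta_pi2 e ep em 1 J phi v Jphi epN emN).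
  by rewrite (scal_one (K := R_Ring)).
move=> s Us; rewrite /ep /em GRing.scale1r.
by case: (ind_posE theta_pos Us) => [] [-> [-> _]];
  rewrite !GRing.mulr1 GRing.mulr0 ?GRing.addr0 ?GRing.add0r.
Qed.

(* Perturbing e to e_k = e 1_+ + k e 1_- with k < 1 close to 1 keeps a
   regularizer, because e_k(T) = (1 - (1 - k) M) e(T) and (1 - k) M is a
   contraction.  Since e_k 1_+ = e 1_+, P agrees on e(T) x and on
   e_k(T) x = e(T) x - (1 - k) M e(T) x, whence P M e(T) x = 0. *)
Lemma projectors_mul v : P (M v) = zero.
Proof.
have [K [K0 MK]] := linear_norm _ M_lin.
(* [K] bounds the norm of [M]; this choice gives [d * K < 1] and keeps [k = 1 - d] in the range
   allowed by [N0_split]. *)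
pose d := / (K + 1).
have d0 : 0 < d <= 1.
  split; first by apply: Rinv_0_lt_compat; lra.
  by rewrite -Rinv_1; apply: Rinv_le_contravar; lra.
have dK : d * K < 1.
  apply: (Rmult_lt_reg_r (K + 1)); first lra.
  by rewrite /d Rmult_comm -Rmult_assoc Rinv_r; lra.
pose k := 1 - d.
pose ek s := GRing.add (ep s) (GRing.scale k (em s)).
have ekN : Defs.N0 U ek.
  by have [] := N0_split theta_pos (k := k) eN epN; [rewrite /k; lra|].
(* An arbitrary contour is allowed because injectivity of [calc_N0] compares values that may come
   from two different ones. *)
have C_ek J' phi' x : adm J' phi' -> C ek J' phi' x =
    minus (C e J phi x) (scal d (M (C e J phi x))).
  move=> A.
  rewrite (@calc_comb _ _ _ _ _ T_bis theta_pi2 ek ep em k J' phi' x A epN emN) //.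
  rewrite -(P_e _ A) -(M_e _ A) -{3}(projectors_sum (C e J phi x)) /k.
  by vector.
have ek_ind s : U s -> GRing.mul (ek s) (ind_pos s) = ep s.
  move=> Us; rewrite /ek /ep /em; case: (ind_posE theta_pos Us) => [] [-> [-> _]].
    by rewrite GRing.mulr0 GRing.scaler0 GRing.addr0 !GRing.mulr1.
  by rewrite !GRing.mulr0.
have ekpN : Defs.N0 U (fun s => GRing.mul (ek s) (ind_pos s)).
  apply: (N0_dominated epN) => [|s Us]; last by rewrite ek_ind //; apply: Rle_refl.
  (* A combination with [k = 0] carries intrinsicness from [ep] to a function that equals it only on
     the double sector. *)
  apply: (intrinsic_comb (k := 0) (proj1 epN) (proj1 epN)) => s Us.
  by rewrite ek_ind // GRing.scale0r GRing.addr0.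
have ek_reg : regularizer omega theta T (@ind_pos n) ek.
  split=> // x x' w [phi1 [J1 [p1 I1 H1]]] [phi2 [J2 [p2 I2 H2]]].
  have A1 : adm J1 phi1 by []. have A2 : adm J2 phi2 by [].
  apply: C_inj; set y := C e J phi x; set y' := C e J phi x'.
  have E : minus y y' = scal d (M (minus y y')).
    have := calc_eq A2 H2; rewrite (calc_eq A1 H1).
    rewrite !C_ek // -/y -/y' => E; apply: inner_ext => z.
    rewrite {2}/minus (linear_plus _ M_lin) (linear_opp _ _ M_lin) !innerE.
    by have := congr1 (inner z) E; rewrite !innerE; lra.
  have N0 : norm (minus y y') = 0.
    have : norm (minus y y') <= d * K * norm (minus y y').
      rewrite {1}E; apply: Rle_trans (norm_scal _ _) _.
      rewrite /abs /= Rabs_pos_eq; last lra.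
      by rewrite Rmult_assoc; apply: Rmult_le_compat_l; [lra|apply: MK].
    by have := norm_ge_0 (minus y y'); nra.
  have := norm_eq_zero _ N0 => Z.
  by apply: inner_ext => z; have := congr1 (inner z) Z; rewrite !innerE; lra.
apply: C_inj; rewrite -P_C // -M_C // (linear_zero _ C_lin).
set y := C e J phi v.
have E1 : P (C ek J phi v) = P y.
  rewrite (P_e _ Jphi).
  have -> : P (C ek J phi v) = C (fun s => GRing.mul (ek s) (ind_pos s)) J phi v.
    by apply: op_fun_eq => //; apply: calc_Ninfty_regularized.
  rewrite (@calc_comb _ _ _ _ _ T_bis theta_pi2 _ ep ep 0 J phi v Jphi epN epN).
    by rewrite (scal_zero_l (K := R_Ring)) plus_zero_r.
  by move=> s Us; rewrite ek_ind // GRing.scale0r GRing.addr0.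
move: E1; rewrite C_ek // -/y /minus (linear_plus _ P_lin) (linear_opp _ _ P_lin).
rewrite (linear_scal _ P_lin) => E1; apply: inner_ext => z.
have := congr1 (inner z) E1; rewrite !innerE => E2.
have : d * inner z (P (M y)) = 0 by lra.
by case/Rmult_integral; lra.
Qed.

End Projectors.

(** * The direct sum decomposition *)

Lemma imag_sphere_gen n (i : 'I_n) : imag_sphere (gen R i).
Proof.
exists (fun j => if j == i then R1 else R0); split.
  rewrite (bigD1 i) //= eqxx big1 ?GRing.addr0 ?GRing.expr1n // => j /negPf ->.
  by rewrite GRing.expr0n.
rewrite (bigD1 i) //= eqxx big1 ?GRing.addr0 ?GRing.scale1r // => j /negPf ->.
by rewrite GRing.scale0r.
Qed.

Theorem lemma4p4 (n : nat) (V : rightHilbertModule n) (T : operator V)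
    (omega theta : R) :
  (0 < n)%N ->
  0 < omega < PI / 2 ->
  op_injective T ->
  bisectorial omega T ->
  bounded_Hinfty_calculus omega T ->
  omega < theta < PI / 2 ->
  let V_pos := ran (P_pos omega theta T) in
  let V_neg := ran (P_neg omega theta T) in
  (closed V_pos /\ right_submodule V_pos) /\
  (closed V_neg /\ right_submodule V_neg) /\
  (forall v : V, exists v_pos v_neg : V,
     V_pos v_pos /\ V_neg v_neg /\ v = plus v_pos v_neg) /\
  (forall v : V, V_pos v /\ V_neg v <-> v = zero).
Proof.
move=> n0 omega_pi2 _ T_bis T_calc theta_pi2 V_pos V_neg.
have theta_pos : 0 < theta < PI / 2 by lra.
have [C _ HC] := T_calc theta theta_pi2.
have [P_bnd _] := HC _ (Ninfty_ind_pos theta_pos).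
have [M_bnd _] := HC _ (Ninfty_ind_neg theta_pos).
(* Here [0 < n] enters: without generators [imag_sphere] is empty. *)
pose J := gen R (Ordinal n0).
have A : admissible omega theta J ((omega + theta) / 2).
  by split; [exact: imag_sphere_gen|lra].
(* The regularizer is read off from the value of [P_pos] at [zero], which exists by boundedness. *)
have [e e_reg _] : exists2 e, regularizer omega theta T (@ind_pos n) e & True.
  by case: P_bnd => _ /(_ zero) [w [e ? _]] _; exists e.
pose P := op_fun (P_pos omega theta T); pose M := op_fun (P_neg omega theta T).
have sum v : plus (P v) (M v) = v.
  exact: (projectors_sum T_bis theta_pi2 A P_bnd M_bnd e_reg).
have PM v : P (M v) = zero.
  exact: (projectors_mul T_bis theta_pi2 A P_bnd M_bnd e_reg).
have P_lin : is_linear P by apply: op_fun_linear.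
have M_lin : is_linear M by apply: op_fun_linear.
have PP v : P (P v) = P v.
  by rewrite -[in RHS](sum v) (linear_plus _ P_lin) PM plus_zero_r.
have MP v : M (P v) = zero.
  apply: inner_ext => z; have := congr1 (inner z) (sum (P v)).
  by rewrite PP !innerE; lra.
(* Each range is the kernel of the other projector, which gives both closedness and the trivial
   intersection. *)
have posE v : V_pos v <-> M v = zero.
  rewrite /V_pos ran_op_fun //; split=> [[w ->] //|Mv].
  by exists v; rewrite -{1}(sum v) Mv plus_zero_r.
have negE v : V_neg v <-> P v = zero.
  rewrite /V_neg ran_op_fun //; split=> [[w ->] //|Pv].
  by exists v; rewrite -{1}(sum v) Pv plus_zero_l.
split; [|split; [|split]].
- split; last exact: ran_right_submodule.
  by apply: closed_ext (closed_kernel M_lin) => v; rewrite posE.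
- split; last exact: ran_right_submodule.
  by apply: closed_ext (closed_kernel P_lin) => v; rewrite negE.
- by move=> v; exists (P v), (M v); rewrite posE negE.
move=> v; rewrite posE negE; split=> [[Mv Pv]|->].
  by rewrite -(sum v) Mv Pv plus_zero_l.
by rewrite (linear_zero _ P_lin) (linear_zero _ M_lin).
Qed.
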